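(* Let $G$ be a finite planar graph with no two intersecting triangles and such that every triangle of $G$ is adjacent to at most one $4$-cycle. Then $G$ is adaptably $3$-choosable (i.e. $\mathrm{ch}_{ad}(G)\le 3$), and hence $G$ is $(3,1)$-choosable.
   Context: A triangle is a $3$-cycle. Two cycles are adjacent if they share a common edge, and intersecting if they have at least one common vertex. Given a (possibly improper) edge coloring $F$ of $G$ with integers, a vertex coloring $c$ is adapted to $F$ if no edge $uv$ satisfies $c(u)=c(v)=F(uv)$. $G$ is adaptably $k$-choosable if for every edge coloring $F$ and every list assignment $L$ with $|L(v)|\ge k$ for all $v$, there is a coloring $c$ adapted to $F$ with $c(v)\in L(v)$ for all $v$; $\mathrm{ch}_{ad}(G)$ is the least such $k$. A $(k,d)$-list assignment assigns to each vertex a list of at least $k$ colors such that adjacent vertices' lists share at most $d$ colors; $G$ is $(k,d)$-choosable if for every such assignment $L$ there is a proper vertex coloring from the lists. *)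

(* Defs.v *)
From HB Require Import structures.
From mathcomp Require Import all_boot all_order all_algebra.
From mathcomp Require Import all_classical all_reals all_analysis.
Set Implicit Arguments. Unset Strict Implicit. Unset Printing Implicit Defensive.
Import Order.TTheory GRing.Theory Num.Theory.
Import numFieldNormedType.Exports.
Local Open Scope ring_scope.

Definition simple_graph (T : finType) (e : rel T) : Prop :=
  symmetric e /\ irreflexive e.

Definition unit_itv (R : realType) : set R := [set t : R | 0 <= t <= 1]%classic.

Definition planar (R : realType) (T : finType) (e : rel T) : Prop :=
  exists (pos : T -> R * R) (arc : T -> T -> R -> R * R),
    injective pos /\
    forall u v, e u v ->
      [/\ {within @unit_itv R, continuous (arc u v)}%classic,
          (forall s t, 0 <= s <= 1 -> 0 <= t <= 1 -> arc u v s = arc u v t -> s = t),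
          arc u v 0 = pos u /\ arc u v 1 = pos v,
          (forall w t, 0 <= t <= 1 -> arc u v t = pos w -> w = u \/ w = v) &
          (forall x y s t, e x y -> [set u; v]%SET != [set x; y]%SET ->
             0 <= s <= 1 -> 0 <= t <= 1 -> arc u v s = arc x y t ->
             exists2 w, w \in ([set u; v] :&: [set x; y])%SET & arc u v s = pos w)].

Definition is_triangle (T : finType) (e : rel T) (S : {set T}) : bool :=
  [exists a, exists b, exists c,
     [&& e a b, e b c, e c a, a != b, b != c, a != c &
         S == [set a; b; c]%SET]].

Definition triangle_edges (T : finType) (S : {set T}) : {set {set T}} :=
  [set E : {set T} | (E \subset S) && (#|E| == 2)].

Definition is_4cycle (T : finType) (e : rel T) (C : {set {set T}}) : bool :=
  [exists a, exists b, exists c, exists d,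
     [&& e a b, e b c, e c d, e d a,
         uniq [:: a; b; c; d] &
         C == [set [set a; b]; [set b; c]; [set c; d]; [set d; a]]%SET]].

Definition triangle_adj_4cycle (T : finType) (S : {set T}) (C : {set {set T}}) : bool :=
  [exists E, (E \in triangle_edges S) && (E \in C)].

Definition no_intersecting_triangles (T : finType) (e : rel T) : Prop :=
  forall S1 S2 : {set T}, is_triangle e S1 -> is_triangle e S2 -> S1 != S2 ->
    [disjoint S1 & S2].

Definition triangles_adj_at_most_one_4cycle (T : finType) (e : rel T) : Prop :=
  forall S : {set T}, is_triangle e S ->
    (#|[set C : {set {set T}} | is_4cycle e C & triangle_adj_4cycle S C]| <= 1)%N.

(* Colors are integers; lists are sequences of integers, whose size is the
   number of distinct colors in them. *)
Definition list_size (l : seq int) : nat := size (undup l).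

Definition adapted (T : finType) (e : rel T) (F : {set T} -> int) (c : T -> int) : Prop :=
  forall u v, e u v -> ~ (c u = F [set u; v]%SET /\ c v = F [set u; v]%SET).

Definition adaptably_choosable (T : finType) (e : rel T) (k : nat) : Prop :=
  forall (F : {set T} -> int) (L : T -> seq int),
    (forall v, k <= list_size (L v))%N ->
    exists c : T -> int, (forall v, c v \in L v) /\ adapted e F c.

Definition kd_choosable (T : finType) (e : rel T) (k d : nat) : Prop :=
  forall L : T -> seq int,
    (forall v, k <= list_size (L v))%N ->
    (forall u v, e u v -> size [seq x <- undup (L u) | x \in L v] <= d)%N ->
    exists c : T -> int, (forall v, c v \in L v) /\ (forall u v, e u v -> c u != c v).

(* Main.v *)
Require Import Defs.
From mathcomp Require Import all_boot all_order all_algebra all_fingroup.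
From mathcomp Require boolp.
From mathcomp Require Import zify.
Set Implicit Arguments. Unset Strict Implicit. Unset Printing Implicit Defensive.

(** If every edge of [G] can choose one of its ends so that each vertex is chosen
    at most twice, colour each vertex with a colour of its list different from
    [F E] for the (at most two) edges [E] that chose it: the result is adapted to
    [F].  By Hakimi's theorem such a choice exists as soon as every vertex set [S]
    spans at most [2 |S|] edges.

    This bound comes from Euler's formula in the homological form of Mac Lane: the
    cycle space of a plane graph is the cut space of its dual graph, so it has
    dimension at most the number of faces.  Giving a face of length [l] the
    charge [2 l - 8], each triangle receives 1 through every edge shared with a
    face of length at least 5; the hypotheses on triangles then make all charges
    nonnegative, unless two edges are in series, in which case both are deleted.

    To get the dual graph without the Jordan curve theorem, the drawing is
    discretised: by compactness, [G] is a minor of a finite square grid.  The faces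
    are the classes of grid pixels under adjacency across grid edges not used by
    the minor, and a cycle bounds the set of pixels from which a horizontal ray
    crosses it an odd number of times. *)

(** * Orientations and list colouring *)

Section Orientation.
Variable T : finType.
Implicit Types (A : {set {set T}}) (f : {set T} -> T).

Definition owned A f (u : T) := [set E in A | f E == u].

(** A step from $u$ to $w$ is an edge owned by $u$ that can be handed over to its end $w$. *)
Definition owner_rel A f : rel T := fun u w => [exists E in owned A f u, w \in E].

(* Reversing the edges along a simple path moves one unit of out-degree from
   its first vertex to its last one. *)
Lemma reroute A k p f a :
  {in A, forall E, f E \in E} ->
  uniq (a :: p) -> path (owner_rel A f) a p ->
  (forall u, #|owned A f u| <= k + (u == a)) ->
  #|owned A f (last a p)| < k + (last a p == a) ->
  exists2 g : {set T} -> T, {in A, forall E, g E \in E} & forall u, #|owned A g u| <= k.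
Proof.
elim: p f a => [|b p IH] f a fin /=.
  move=> _ _ le; rewrite eqxx addn1 ltnS => lea; exists f => // u.
  by have := le u; case: eqP => [->|_] //; rewrite addn0.
move=> /andP[anp up] /andP[/existsP[E /andP[EA bE]] pp] le lt.
move: EA; rewrite inE => /andP[EA /eqP fE].
have nab : b != a by apply: contraNneq anp => <-; rewrite mem_head.
pose g X := if X == E then b else f X.
have gin : {in A, forall X, g X \in X}.
  by move=> X XA; rewrite /g; case: (eqVneq X E) => [->|_] //; apply: fin.
have ownE u : u != a -> u != b -> owned A g u = owned A f u.
  move=> ua ub; apply/setP => X; rewrite !inE /g; case: (eqVneq X E) => [->|_] //.
  by rewrite fE ![_ == u]eq_sym (negPf ub) (negPf ua).
have owna : owned A g a = owned A f a :\ E.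
  by apply/setP => X; rewrite !inE /g; case: (eqVneq X E) => [->|_] //=; rewrite (negPf nab) andbF.
have ownb : owned A g b = E |: owned A f b.
  apply/setP => X; rewrite !inE /g; case: (eqVneq X E) => [->|_] //=.
  by rewrite eqxx EA.
have Ea : E \in owned A f a by rewrite inE EA fE eqxx.
have En : E \notin owned A f b by rewrite inE EA fE eq_sym.
have la : last b p != a.
  by apply: contraNneq anp => <-; apply: mem_last.
apply: (IH g b) => //.
- apply: (@sub_in_path _ (predC1 a) (owner_rel A f)); last exact: pp.
    move=> x y xa _ /existsP[X /andP[]]; rewrite inE => /andP[XA /eqP fX] yX.
    apply/existsP; exists X; rewrite inE XA yX /g andbT /=.
    case: (eqVneq X E) => [XE|_]; last by rewrite fX.
    by case/eqP: xa; rewrite -fX XE.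
  apply/allP => x xp /=; apply: contraNneq anp => <-.
  exact: xp.
- move=> u; case: (eqVneq u b) => [->|ub].
    by rewrite ownb cardsU1 En addnC leq_add2r; have := le b; rewrite (negPf nab) addn0.
  rewrite addn0; case: (eqVneq u a) => [->|ua]; last first.
    by rewrite ownE //; have := le u; rewrite (negPf ua) addn0.
  by rewrite owna; have := le a; rewrite (cardsD1 E (owned A f a)) Ea eqxx addnC leq_add2r.
- case: (eqVneq (last b p) b) lt => [->|lb] lt.
    rewrite ownb cardsU1 En addnC ltn_add2r.
    by move: lt; rewrite (negPf nab) addn0.
  by move: lt; rewrite ownE // (negPf la) !addn0.
Qed.

(* The capacity-[k] form of Hall's theorem for edges choosing one of their ends
   (Hakimi's orientation theorem). *)
Lemma bounded_orientation A k (x0 : T) :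
  {in A, forall E : {set T}, E != set0} ->
  (forall S : {set T}, #|[set E in A | E \subset S]| <= k * #|S|) ->
  exists2 f : {set T} -> T,
    {in A, forall E, f E \in E} & forall u, #|owned A f u| <= k.
Proof.
move=> A0 AS.
suff: forall n (B : {set {set T}}), #|B| = n -> B \subset A -> exists2 f : {set T} -> T,
    {in B, forall E, f E \in E} & forall u, #|owned B f u| <= k.
  by move/(_ _ A erefl (subxx A)).
elim=> [|n IH] B.
  move/eqP; rewrite cards_eq0 => /eqP-> _.
  exists (fun=> x0) => [E|u]; first by rewrite inE.
  by rewrite /owned (eq_card0 (A := [set E in set0 | x0 == u])) // => E; rewrite !inE.
move=> cB sBA.
have [E EB] : exists E, E \in B by apply/set0Pn; rewrite -card_gt0 cB.
have [||f fin fle] := IH (B :\ E).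
- by apply/eqP; rewrite -eqSS -cB (cardsD1 E B) EB.
- by apply: subset_trans sBA; apply: subsetDl.
have /set0Pn[a aE] : E != set0 by apply: A0; apply: (subsetP sBA).
pose g X := if X == E then a else f X.
have gin : {in B, forall X, g X \in X}.
  move=> X XB; rewrite /g; case: eqVneq => [->|XE] //.
  by apply: fin; rewrite !inE XE.
have ownD u : u != a -> owned B g u = owned (B :\ E) f u.
  move=> ua; apply/setP => X; rewrite !inE /g; case: (eqVneq X E) => //= ->.
  by rewrite eq_sym (negPf ua) andbF.
have owna : owned B g a = E |: owned (B :\ E) f a.
  apply/setP => X; rewrite !inE /g; case: (eqVneq X E) => //= ->.
  by rewrite EB eqxx.
have gle u : #|owned B g u| <= k + (u == a).
  case: (eqVneq u a) => [->|ua]; last by rewrite ownD // addn0.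
  rewrite owna cardsU1 !inE eqxx /= addnC addn1 addn1 ltnS; exact: fle.
(* [E] was given to [a], so only [a] may exceed $k$. A vertex of [S] with spare capacity lets
   [reroute] repair this. *)
pose S := [set x | connect (owner_rel B g) a x].
have aS : a \in S by rewrite inE connect0.
have [[w /andP[wS lw]]|full] :
    (exists w, (w \in S) && (#|owned B g w| < k + (w == a))) \/
    (forall w, w \in S -> k + (w == a) <= #|owned B g w|).
- case: (pickP [pred w | (w \in S) && (#|owned B g w| < k + (w == a))]) => [w ww|nw].
    by left; exists w.
  by right => w wS; have := nw w; rewrite /= wS /= ltnNge => /negbFE.
- move: wS; rewrite inE => /connectP[p0 pp0 wE]; move: lw; rewrite wE.
  case/shortenP: pp0 => p pp up _ lw.
  exact: (reroute gin up pp gle lw).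
(* Otherwise the edges owned by vertices of [S] all lie inside [S], and there are at least $k|S|+1$
   of them. *)
exfalso.
have : \sum_(w in S) (k + (w == a)) <= #|[set X in A | X \subset S]|.
  apply: (@leq_trans (\sum_(w in S) #|owned B g w|)); first exact: leq_sum.
  apply: (@leq_trans #|[set X in B | g X \in S]|).
    rewrite -[leqRHS]sum1_card (partition_big g (mem S)) /=; last first.
      by move=> X; rewrite inE => /andP[].
    apply: leq_sum => w wS; rewrite sum1_card; apply: subset_leq_card.
    apply/subsetP => X; rewrite inE => /andP[XB /eqP gX]; rewrite unfold_in /=.
    by rewrite inE XB gX wS eqxx.
  apply: subset_leq_card; apply/subsetP => X; rewrite !inE => /andP[XB gS].
  rewrite (subsetP sBA) //=; apply/subsetP => y yX; rewrite inE.
  apply: connect_trans gS _; apply: connect1; apply/existsP; exists X.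
  by rewrite inE XB eqxx.
rewrite big_split /= sum_nat_const mulnC (bigD1 a aS) /= eqxx.
by move=> /leq_trans/(_ (AS S)); rewrite addnA addn1 -ltn_subRL subnn.
Qed.
End Orientation.

Definition edge_set (T : finType) (e : rel T) : {set {set T}} :=
  [set E : {set T} | [exists u, exists v, e u v && (E == [set u; v])]].

Lemma edge_setP (T : finType) (e : rel T) (E : {set T}) :
  reflect (exists u v, e u v /\ E = [set u; v]) (E \in edge_set e).
Proof.
rewrite inE; apply: (iffP existsP) => [[u /existsP[v /andP[uv /eqP->]]]|[u [v [uv ->]]]].
  by exists u, v.
by exists u; apply/existsP; exists v; rewrite uv eqxx.
Qed.

Lemma sparse_adaptably_choosable (T : finType) (e : rel T) k :
  (forall S : {set T}, #|[set E in edge_set e | E \subset S]| <= k * #|S|) ->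
  adaptably_choosable e k.+1.
Proof.
move=> sparse F L Lk.
(* [bounded_orientation] takes a vertex [x0] as default value, so the empty vertex set is treated
   apart. *)
have [x0 _|T0] := pickP T; last first.
  have F0 (x : T) : False by have := T0 x.
  by exists (fun=> 0%R); split=> [v|u v]; [case: (F0 v)|case: (F0 u)].
have [|f fin fle] := @bounded_orientation T (edge_set e) k x0 _ sparse.
  move=> E /edge_setP[u [v [_ ->]]]; apply/set0Pn; exists u.
  by rewrite !inE eqxx.
(* One forbidden colour per owned edge: at most [k] of them against [k.+1] colours in the list. *)
pose bad v := [seq F E | E <- enum (owned (edge_set e) f v)].
have good v : exists x, (x \in L v) && (x \notin bad v).
  have [|nh] := boolP (has (fun x => x \notin bad v) (L v)).
    by case/hasP => x xL xb; exists x; rewrite xL.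
  have sub : {subset undup (L v) <= bad v}.
    move=> x; rewrite mem_undup => xL; apply: contraNT nh => xb.
    by apply/hasP; exists x.
  have := uniq_leq_size (undup_uniq (L v)) sub.
  rewrite size_map -cardE => /(leq_trans (Lk v))/leq_trans/(_ (fle v)).
  by rewrite ltnn.
pose c v := xchoose (good v).
have cP v : (c v \in L v) && (c v \notin bad v) := xchooseP (good v).
exists c; split=> [v|u v uv [cu cv]]; first by case/andP: (cP v).
have Euv : [set u; v] \in edge_set e by apply/edge_setP; exists u, v.
have key w : c w = F [set u; v] -> f [set u; v] != w.
  move=> cw; apply: contraTneq (cP w) => fw; rewrite negb_and negbK.
  apply/orP; right; apply/mapP; exists [set u; v] => //.
  by rewrite mem_enum inE Euv fw eqxx.
have := fin _ Euv; rewrite !inE.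
by rewrite (negPf (key u cu)) (negPf (key v cv)).
Qed.

(** Label each edge by the single colour that the lists of its ends may share. Two ends of equal
    colour would both carry that label, which an adapted colouring excludes. An edge whose lists are
    disjoint gets the harmless label 0. *)
Lemma adaptably_choosable_kd (T : finType) (e : rel T) k :
  adaptably_choosable e k -> kd_choosable e k 1.
Proof.
move=> ch L Lk Ld.
pose common (E : {set T}) : seq int :=
  if [pick u in E] is Some u then
    [seq x <- undup (L u) | [forall w in E, x \in L w]] else [::].
have [c [cL cF]] := ch (fun E => head 0%R (common E)) L Lk.
exists c; split=> // u v uv; apply/eqP => cuv.
have comm : common [set u; v] = [:: c u].
  rewrite /common; case: pickP => [w|/(_ u)]; last by rewrite !inE eqxx.
  move=> wE; set s := filter _ _.
  have us : uniq s by rewrite filter_uniq // undup_uniq.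
  have sx x : (x \in s) = (x \in L u) && (x \in L v).
    rewrite mem_filter mem_undup; apply/andP/andP => [[/forall_inP al _]|[xu xv]].
      by split; apply: al; rewrite !inE eqxx ?orbT.
    have al : forall w', w' \in [set u; v] -> x \in L w'.
      by move=> w'; rewrite !inE => /orP[] /eqP->.
    by split; [apply/forall_inP|]; apply: al.
  have cs : c u \in s by rewrite sx cL cuv cL.
  have ss : size s <= 1.
    apply: leq_trans (Ld u v uv); apply: uniq_leq_size => // x.
    by rewrite sx mem_filter mem_undup andbC.
  case: s us sx cs ss => [|y [|//]] //= _ _; rewrite inE => /eqP-> //.
by case: (cF u v uv); rewrite comm /= cuv.
Qed.

(** * Cycle spaces and dual graphs *)

Section CycleSpace.
Variable T : finType.
Implicit Types (A z : {set {set T}}) (E : {set T}).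

Definition symdiff (I : finType) (X Y : {set I}) := (X :\: Y) :|: (Y :\: X).

Lemma in_symdiff (I : finType) (X Y : {set I}) i :
  (i \in symdiff X Y) = (i \in X) (+) (i \in Y).
Proof. by rewrite !inE; case: (i \in X); case: (i \in Y). Qed.

Lemma symdiffK (I : finType) (Z : {set I}) : involutive (fun X => symdiff X Z).
Proof. by move=> X; apply/setP => i; rewrite !in_symdiff -addbA addbb addbF. Qed.

Lemma odd_card_symdiff (I : finType) (X Y : {set I}) :
  odd #|symdiff X Y| = odd #|X| (+) odd #|Y|.
Proof.
rewrite -(cardsID Y X) -(cardsID X Y) cardsU [Y :&: X]setIC.
have -> : (X :\: Y) :&: (Y :\: X) = set0.
  by apply/setP => i; rewrite !inE; case: (i \in X); case: (i \in Y).
rewrite cards0 subn0 !oddD.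
by case: (odd #|X :&: Y|); case: (odd #|X :\: Y|); case: (odd #|Y :\: X|).
Qed.

Definition star z (u : T) := [set E in z | u \in E].

Definition odd_vertices z := [set u | odd #|star z u|].

(** The cycle space over the field with two elements: [symdiff] is addition and [odd_vertices] the
    boundary map. *)
Definition cycle_space A := [set z : {set {set T}} | (z \subset A) && (odd_vertices z == set0)].

Lemma cycle_spaceP A z :
  reflect (z \subset A /\ forall u, ~~ odd #|star z u|) (z \in cycle_space A).
Proof.
rewrite inE; apply: (iffP andP) => [[zA /eqP z0]|[zA z0]]; split=> //.
  by move=> u; have := in_set0 u; rewrite -z0 inE => ->.
by apply/eqP/setP => u; rewrite !inE; apply: negPf.
Qed.

Lemma odd_vertices_symdiff z1 z2 :
  odd_vertices (symdiff z1 z2) = symdiff (odd_vertices z1) (odd_vertices z2).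
Proof.
apply/setP => u; rewrite in_symdiff !in_set -odd_card_symdiff; congr odd.
apply: eq_card => E; rewrite !(in_symdiff, in_set).
by case: (u \in E); rewrite ?andbT ?andbF.
Qed.

Lemma symdiff_sub A z1 z2 : z1 \subset A -> z2 \subset A -> symdiff z1 z2 \subset A.
Proof. by move=> s1 s2; rewrite subUset !subDset !subsetU ?s1 ?s2 ?orbT. Qed.

(* Rank-nullity for the boundary map, over the field with two elements. *)
Lemma card_cycle_space_ge A (S : {set T}) :
  {in A, forall E, E \subset S} -> 2 ^ #|A| <= #|cycle_space A| * 2 ^ #|S|.
Proof.
move=> AS; rewrite -!card_powerset -[leqLHS]sum1_card mulnC -sum_nat_const.
rewrite (partition_big odd_vertices (mem (powerset S))) /=; last first.
  move=> z; rewrite !inE => /subsetP zA; apply/subsetP => u; rewrite inE => /odd_gt0.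
  rewrite card_gt0 => /set0Pn[E]; rewrite inE => /andP[Ez uE].
  exact: (subsetP (AS _ (zA _ Ez))).
(* A nonempty fibre of [odd_vertices] is a coset: adding one member [z0] maps it injectively into
   the cycle space. *)
apply: leq_sum => W _; rewrite sum1_card.
have [->//|/set0Pn[z0]] :
    #|[pred z in powerset A | odd_vertices z == W]| = 0 \/
    [set z : {set {set T}} in powerset A | odd_vertices z == W] != set0.
- case: (eqVneq [set z : {set {set T}} in powerset A | odd_vertices z == W] set0) => [e0|]; [left|by right].
  by rewrite -(cards0 {set {set T}}) -e0; apply: eq_card => z; rewrite !inE.
rewrite !inE => /andP[z0A /eqP z0W].
rewrite -(card_imset _ (can_inj (symdiffK z0))).
apply: subset_leq_card; apply/subsetP => _ /imsetP[z + ->].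
rewrite unfold_in /= powersetE => /andP[zA /eqP zW].
rewrite in_set symdiff_sub // odd_vertices_symdiff zW z0W.
by apply/eqP/setP => u; rewrite in_symdiff inE addbb.
Qed.

(** Cycles avoiding [E1] also avoid [E2], so they live in the smaller edge set; the cycles through
    [E1] are either absent or a coset of these. *)
Lemma card_cycle_space_series A E1 E2 :
  E1 \in A -> {in cycle_space A, forall z, (E1 \in z) = (E2 \in z)} ->
  #|cycle_space A| <= 2 * #|cycle_space (A :\ E1 :\ E2)|.
Proof.
move=> E1A ser; set A' := A :\ E1 :\ E2.
have sub z : z \in cycle_space A -> E1 \notin z -> z \in cycle_space A'.
  move=> zA; have e12 := ser _ zA; move: zA; rewrite !inE => /andP[zA ->] nz.
  by rewrite andbT !subsetD1 zA -e12 nz.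
rewrite -(cardsID [set z : {set {set T}} | E1 \in z]) mul2n -addnn; apply: leq_add; last first.
  by apply: subset_leq_card; apply/subsetP => z; rewrite !in_setD inE => /andP[? ?]; apply: sub.
have [->|/set0Pn[z0]] := eqVneq (cycle_space A :&: [set z : {set {set T}} | E1 \in z]) set0.
  by rewrite cards0.
rewrite in_setI inE => /andP[z0A Ez0].
rewrite -(card_imset _ (can_inj (symdiffK z0))).
apply: subset_leq_card; apply/subsetP => _ /imsetP[z + ->].
rewrite in_setI inE => /andP[zA Ez]; apply: sub; last by rewrite in_symdiff Ez Ez0.
move: zA z0A; rewrite !in_set => /andP[zA /eqP zW] /andP[z0A /eqP z0W].
rewrite symdiff_sub // odd_vertices_symdiff zW z0W.
by apply/eqP/setP => u; rewrite in_symdiff inE addbb.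
Qed.

(* [l] and [r] name the two faces beside each edge: the cuts of this dual graph
   are the cycles of [A]. *)
Definition has_dual A := exists (I : finType) (l r : {set T} -> I),
  (forall J : {set I}, [set E in A | (l E \in J) (+) (r E \in J)] \in cycle_space A) /\
  (forall z, z \in cycle_space A -> exists J : {set I},
     z = [set E in A | (l E \in J) (+) (r E \in J)]).
End CycleSpace.

(** * Elements of the cycle space with at most four edges *)

Section SmallCycles.
Variables (T : finType) (e : rel T).
Hypotheses (e_sym : symmetric e) (e_irr : irreflexive e).
Implicit Types (A z : {set {set T}}) (E : {set T}).

Lemma set2_inj_r (a b c : T) : [set a; b] = [set a; c] -> b = c.
Proof.
move=> eq2; have := set22 a b; rewrite eq2 !inE => /orP[/eqP ba|/eqP//].
by have := set22 a c; rewrite -eq2 ba !inE orbb => /eqP.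
Qed.

Lemma edge_set_at E u : E \in edge_set e -> u \in E -> exists2 v, e u v & E = [set u; v].
Proof.
case/edge_setP=> a [b [ab ->]]; rewrite !inE => /orP[] /eqP->; first by exists b.
by exists a; rewrite 1?e_sym // setUC.
Qed.

Lemma edge_card E : E \in edge_set e -> #|E| = 2.
Proof.
case/edge_setP=> a [b [ab ->]]; rewrite cards2.
by case: eqVneq ab => // ->; rewrite e_irr.
Qed.

(** The degree of [b] in [z] is even and positive, hence at least 2: a walk in [z] can go on without
    turning back. *)
Lemma cycle_next z a b : z \in cycle_space (edge_set e) -> [set a; b] \in z ->
  exists c, [/\ e b c, c != a & [set b; c] \in z].
Proof.
move=> /cycle_spaceP[zA ev] abz.
have : 1 < #|star z b|.
  have : [set a; b] \in star z b by rewrite inE abz set22.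
  rewrite ltn_neqAle => abs; rewrite card_gt0 andbC; apply/andP; split.
    by apply/set0Pn; exists [set a; b].
  by apply: contraNneq (ev b) => <-.
rewrite (cardsD1 [set a; b]) inE abz set22 ltnS card_gt0 => /set0Pn[E].
rewrite !inE => /andP[nE /andP[Ez bE]].
have [c bc EE] := edge_set_at (subsetP zA _ Ez) bE.
exists c; split; rewrite -?EE //.
by apply: contraNneq nE => <-; rewrite EE setUC.
Qed.

Lemma edge_neq a b : e a b -> a != b.
Proof. by apply: contraTneq => ->; rewrite e_irr. Qed.

Lemma neq_set2 (a b c d : T) : a != c -> a != d -> [set a; b] != [set c; d].
Proof.
move=> ac ad; apply/eqP => eq2; have := set21 a b.
by rewrite eq2 !inE (negPf ac) (negPf ad).
Qed.

(** Follow [z] from an edge $ab$ through $c$, $d$, $x$. If the walk does not close up at $a$ after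
    three or four steps, its four edges and a second edge of [z] at $a$ are five distinct edges. *)
Lemma small_cycle z : z \in cycle_space (edge_set e) -> z != set0 ->
  [\/ exists a b c, [/\ e a b, e b c, e c a &
        [set [set a; b]; [set b; c]; [set c; a]] \subset z],
      exists a b c d, [/\ [/\ e a b, e b c, e c d & e d a], uniq [:: a; b; c; d] &
        [set [set a; b]; [set b; c]; [set c; d]; [set d; a]] \subset z] |
      4 < #|z|].
Proof.
move=> zZ /set0Pn[E Ez]; have /cycle_spaceP[zA _] := zZ.
have /edge_setP[a [b [ab EE]]] := subsetP zA _ Ez; rewrite {}EE in Ez.
have [c [bc ca bcz]] := cycle_next zZ Ez.
have [d [cd db cdz]] := cycle_next zZ bcz.
have [[nab nbc] ncd] := (edge_neq ab, edge_neq bc, edge_neq cd).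
case: (eqVneq d a) => [da|da].
  rewrite da in cd db cdz; apply: Or31; exists a, b, c; split=> //.
  by apply/subsetP => X; rewrite !inE -orbA => /or3P[] /eqP->.
have [x [dx xc dxz]] := cycle_next zZ cdz.
have ndx := edge_neq dx.
case: (eqVneq x a) => [xa|xa].
  rewrite xa in dx xc dxz.
  apply: Or32; exists a, b, c, d; split=> //.
    by rewrite /= !inE !negb_or nab nbc ncd eq_sym ca eq_sym da eq_sym db.
  by apply/subsetP => X; rewrite !inE -!orbA => /or4P[] /eqP->.
have [y [ay yb ayz]] := cycle_next zZ (z := z) (a := b) (b := a) ltac:(by rewrite setUC).
have nay := edge_neq ay.
have [ac ad ax] : [/\ a != c, a != d & a != x] by rewrite eq_sym ca eq_sym da eq_sym xa.
have [bd dc] : b != d /\ d != c by rewrite eq_sym db eq_sym ncd.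
have dif (p q q' : T) : q != q' -> [set p; q] != [set p; q'].
  by apply: contraNneq => /set2_inj_r->.
apply: Or33.
have := @uniq_leq_size _
  [:: [set a; y]; [set a; b]; [set b; c]; [set c; d]; [set d; x]] (enum z).
rewrite -cardE; apply=> [|X]; last first.
  by rewrite !inE mem_enum => /or4P[|||/orP[]] /eqP->.
have bcdx : [set b; c] != [set d; x] by rewrite eq_sym neq_set2 // 1?eq_sym.
have cddx : [set c; d] != [set d; x] by rewrite [X in X != _]setUC dif 1?eq_sym.
by rewrite /= !inE !negb_or bcdx cddx dif // !neq_set2.
Qed.

Lemma card_triangle_edges (a b c : T) : e a b -> e b c -> e c a ->
  #|[set [set a; b]; [set b; c]; [set c; a]]| = 3.
Proof.
move=> /edge_neq ab /edge_neq bc /edge_neq ca.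
have ac : a != c by rewrite eq_sym.
have abca : [set a; b] != [set c; a].
  by apply: contraNneq bc; rewrite [[set c; a]]setUC => /set2_inj_r->.
have bcca : [set b; c] != [set c; a] by rewrite neq_set2 // eq_sym.
by rewrite -setUA !cardsU1 cards1 !inE !negb_or abca bcca neq_set2.
Qed.

Lemma card_4cycle_edges (a b c d : T) : uniq [:: a; b; c; d] ->
  #|[set [set a; b]; [set b; c]; [set c; d]; [set d; a]]| = 4.
Proof.
rewrite /= !inE !negb_or andbT => /andP[/and3P[ab ac ad] /andP[/andP[bc bd] cd]].
rewrite -!setUA !cardsU1 cards1 !inE !negb_or.
have -> : [set a; b] != [set d; a].
  by apply: contraNneq bd; rewrite [[set d; a]]setUC => /set2_inj_r->.
have -> : [set c; d] != [set d; a] by rewrite neq_set2 // eq_sym.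
have -> : [set b; c] != [set d; a] by rewrite neq_set2 // eq_sym.
by rewrite !neq_set2.
Qed.

Lemma cycle_card_ge3 z : z \in cycle_space (edge_set e) -> z != set0 -> 2 < #|z|.
Proof.
move=> zZ z0; case: (small_cycle zZ z0) => [[a [b [c [ab bc ca]]]]|[a [b [c [d [_ u]]]]]|].
- by move/subset_leq_card; rewrite card_triangle_edges.
- by move/subset_leq_card; rewrite card_4cycle_edges //; apply: leq_trans.
- exact: leq_trans.
Qed.

Lemma cycle3_triangle z : z \in cycle_space (edge_set e) -> #|z| = 3 ->
  is_triangle e (cover z) /\ z = triangle_edges (cover z).
Proof.
move=> zZ z3; have z0 : z != set0 by rewrite -card_gt0 z3.
case: (small_cycle zZ z0) => [[a [b [c [ab bc ca s]]]]|[a [b [c [d [_ u]]]]]|]; last first.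
- by rewrite z3.
- by move/subset_leq_card; rewrite card_4cycle_edges // z3.
have zE : z = [set [set a; b]; [set b; c]; [set c; a]].
  by apply/esym/eqP; rewrite eqEcard s card_triangle_edges // z3.
have [[nab nbc] nca] := (edge_neq ab, edge_neq bc, edge_neq ca).
have cz : cover z = [set a; b; c].
  rewrite zE /cover !bigcup_setU !big_set1.
  by apply/setP => x; rewrite !inE; case: (x == a); case: (x == b); case: (x == c).
split.
  apply/existsP; exists a; apply/existsP; exists b; apply/existsP; exists c.
  by rewrite ab bc ca nab nbc eq_sym nca cz eqxx.
have c3 : #|[set a; b; c]| = 3.
  by rewrite -setUA !cardsU1 cards1 !inE negb_or nab nbc eq_sym nca.
apply/eqP; rewrite eqEcard z3 cz /triangle_edges cards_draws c3 andbT.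
apply/subsetP => E Ez; rewrite inE -cz (bigcup_sup E) //=.
by have /cycle_spaceP[/subsetP zA _] := zZ; rewrite (edge_card (zA _ Ez)).
Qed.

(** A triangle with one more edge $xy$ is impossible: [z] has another edge at $x$ and at $y$,
    necessarily of the triangle, so $xy$ joins two vertices of the triangle and is one of its edges
    already. *)
Lemma cycle4_4cycle z :
  z \in cycle_space (edge_set e) -> #|z| = 4 -> is_4cycle e z.
Proof.
move=> zZ z4; have z0 : z != set0 by rewrite -card_gt0 z4.
case: (small_cycle zZ z0) => [[a [b [c [ab bc ca s]]]]|[a [b [c [d [[ab bc cd da] u s]]]]]|].
- have t3 := card_triangle_edges ab bc ca; set t := [set _; _; _] in s t3.
  have tabc x y : [set x; y] \in t -> x \in [:: a; b; c].
    by rewrite !inE -orbA => /or3P[] /eqP eq2; have := set21 x y; rewrite eq2 !inE;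
      case/orP=> ->; rewrite ?orbT.
  have /set0Pn[E] : z :\: t != set0.
    by rewrite -card_gt0 cardsD (setIidPr s) z4 t3.
  rewrite inE => /andP[nEt Ez].
  have zE X : X \in z -> X != E -> X \in t.
    have <- : E |: t = z.
      by apply/eqP; rewrite eqEcard cardsU1 nEt t3 z4 subUset sub1set Ez s.
    by rewrite in_setU1 => /orP[->|].
  have /cycle_spaceP[/subsetP zA _] := zZ.
  have /edge_setP[x [y [xy EE]]] := zA _ Ez.
  have nxy := edge_neq xy; rewrite {}EE in Ez nEt zE.
  have [w [yw wx ywz]] := cycle_next zZ Ez.
  have [v [xv vy xvz]] := @cycle_next z y x zZ ltac:(by rewrite setUC).
  have xt : x \in [:: a; b; c].
    apply: (tabc x v); apply: zE => //; by apply: contraNneq vy => /set2_inj_r->.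
  have yt : y \in [:: a; b; c].
    apply: (tabc y w); apply: zE => //; rewrite [X in _ != X]setUC.
    by apply: contraNneq wx => /set2_inj_r->.
  case/negP: nEt; move: xt yt nxy; rewrite /t !inE.
  have s2 (p q : T) : [set p; q] == [set q; p] by rewrite setUC.
  by do 2![case/or3P => /eqP->]; rewrite ?eqxx // => _; rewrite ?eqxx ?s2 ?orbT.
- apply/existsP; exists a; apply/existsP; exists b.
  apply/existsP; exists c; apply/existsP; exists d.
  rewrite ab bc cd da u /=.
  by rewrite eq_sym eqEcard s card_4cycle_edges // z4.
- by rewrite z4.
Qed.
End SmallCycles.

(** * Discharging *)

Section Discharging.
Variables (T : finType) (e : rel T).
Hypotheses (e_sym : symmetric e) (e_irr : irreflexive e).
Hypotheses (e_nit : no_intersecting_triangles e).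
Hypotheses (e_adj : triangles_adj_at_most_one_4cycle e).
Implicit Types (A z : {set {set T}}) (E : {set T}).

Lemma cycle_spaceS A z : A \subset edge_set e -> z \in cycle_space A ->
  z \in cycle_space (edge_set e).
Proof.
by move=> sA /cycle_spaceP[zA ev]; apply/cycle_spaceP; split=> //; apply: subset_trans sA.
Qed.

Lemma triangles_meet z1 z2 E1 E2 x :
  z1 \in cycle_space (edge_set e) -> z2 \in cycle_space (edge_set e) ->
  #|z1| = 3 -> #|z2| = 3 -> E1 \in z1 -> E2 \in z2 -> x \in E1 -> x \in E2 -> z1 = z2.
Proof.
move=> zZ1 zZ2 z13 z23 Ez1 Ez2 x1 x2.
have [t1 ->] := cycle3_triangle e_sym e_irr zZ1 z13.
have [t2 ->] := cycle3_triangle e_sym e_irr zZ2 z23.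
congr triangle_edges; apply/eqP; apply: contraT => ne.
have := e_nit t1 t2 ne; rewrite disjoint_subset => /subsetP/(_ x).
rewrite !inE => /(_ _)/negP; case; first by apply/bigcupP; exists E1.
by apply/bigcupP; exists E2.
Qed.

Lemma triangle_4cycle_unique z z1 z2 E1 E2 :
  z \in cycle_space (edge_set e) -> z1 \in cycle_space (edge_set e) ->
  z2 \in cycle_space (edge_set e) -> #|z| = 3 -> #|z1| = 4 -> #|z2| = 4 ->
  E1 \in z -> E1 \in z1 -> E2 \in z -> E2 \in z2 -> z1 = z2.
Proof.
move=> zZ zZ1 zZ2 z3 z14 z24 E1z E1z1 E2z E2z2.
have [tz zE] := cycle3_triangle e_sym e_irr zZ z3.
have /card_le1_eqP := e_adj tz; apply; rewrite inE cycle4_4cycle //= /triangle_adj_4cycle.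
  by apply/existsP; exists E2; rewrite -zE E2z.
by apply/existsP; exists E1; rewrite -zE E1z.
Qed.

(** Double counting of incidences: every covered vertex has degree at least 2, every edge has two
    ends. *)
Lemma cycle_cover z : z \in cycle_space (edge_set e) -> #|cover z| <= #|z|.
Proof.
move=> /cycle_spaceP[/subsetP zA ev]; rewrite -(leq_pmul2l (isT : 0 < 2)).
apply: (@leq_trans (\sum_(u in cover z) #|star z u|)).
  rewrite mulnC -sum_nat_const; apply: leq_sum => u /bigcupP[E Ez uE].
  have : 0 < #|star z u| by rewrite card_gt0; apply/set0Pn; exists E; rewrite inE Ez.
  by have := ev u; case: #|_| => [|[|]].
rewrite mulnC -sum_nat_const.
under eq_bigr do rewrite -sum1_card (eq_bigl _ _ (fun E => in_set _ _)) /= big_mkcondr /=.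
rewrite exchange_big /=; apply: leq_sum => E Ez.
rewrite -big_mkcondr sum1_card -(edge_card e_irr (zA _ Ez)).
by apply: subset_leq_card; apply/subsetP => u; rewrite unfold_in /= => /andP[].
Qed.

(** With $d$ the dimension of the cycle space and $f$ the number of faces with nonempty boundary,
    the dual gives $d\le f$ and discharging gives $2f\le |A|$. *)
Lemma no_series_card A :
  A \subset edge_set e -> has_dual A ->
  (forall E1 E2, E1 \in A -> E2 \in A ->
     {in cycle_space A, forall z, (E1 \in z) = (E2 \in z)} -> E1 = E2) ->
  #|cycle_space A| ^ 2 <= 2 ^ #|A|.
Proof.
move=> sA [I [l [r [cut_cycle cycle_cut]]]] noser.
(* [B i] is the boundary of the face [i], the cut of a single dual vertex. An edge with the same
   face on both sides lies in no boundary. *)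
pose B i := [set E in A | (l E == i) (+) (r E == i)].
(* The face across [E]. As a transposition it is an involution of all of [I], by which sums over
   faces can be reindexed. *)
pose oth E i : I := tperm (l E) (r E) i.
have othK E : involutive (oth E) by move=> i; rewrite /oth tpermK.
have BZ' i : B i \in cycle_space A.
  suff -> : B i = [set E in A | (l E \in [set i]) (+) (r E \in [set i])].
    exact: cut_cycle.
  by apply/setP => E; rewrite !inE.
have BZ i := cycle_spaceS sA (BZ' i).
have Both E i : (E \in B (oth E i)) = (E \in B i).
  rewrite !inE /oth; congr (_ && _).
  by case: tpermP => [->|->|] //; rewrite !eqxx addbC [r E == l E]eq_sym.
have BoN E i : E \in B i -> oth E i != i.
  rewrite inE /oth => /andP[_]; case: tpermP => [<-|<-|ni nj].
  - by rewrite eqxx; case: eqP.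
  - by rewrite eqxx addbC; case: eqP.
  by move/eqP/negPf: ni; rewrite eq_sym => ->; move/eqP/negPf: nj; rewrite eq_sym => ->.
have Btwo E i j : E \in B i -> E \in B j -> j != i -> j = oth E i.
  rewrite !inE /oth => /andP[_ hi] /andP[_ hj] ji.
  have [li|li] := eqVneq (l E) i.
    by move: hj; rewrite li eq_sym (negPf ji) /= => /eqP<-; rewrite tpermL.
  move: hi hj; rewrite (negPf li) /= => /eqP->; rewrite [i == j]eq_sym (negPf ji).
  by rewrite addbF => /eqP<-; rewrite tpermR.
(* Two edges between the same two faces lie in the same cuts, hence in the same cycles: they are in
   series. *)
have Bsimple i j E1 E2 : i != j -> E1 \in B i -> E1 \in B j -> E2 \in B i ->
    E2 \in B j -> E1 = E2.
  move=> ij E1i E1j E2i E2j.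
  have side E : E \in B i -> E \in B j -> forall J : {set I},
      (l E \in J) (+) (r E \in J) = (i \in J) (+) (j \in J).
    move=> Ei Ej J; rewrite (Btwo _ _ _ Ei Ej) 1?eq_sym //.
    move: Ei; rewrite inE /oth => /andP[_]; case: tpermP => [->|->|ni nj] //.
      by move=> _; rewrite addbC.
    by move/eqP/negPf: ni; rewrite eq_sym => ->; move/eqP/negPf: nj; rewrite eq_sym => ->.
  have inA E : E \in B i -> E \in A by rewrite inE => /andP[].
  apply: noser; rewrite ?inA // => z /cycle_cut[J ->].
  by rewrite !inE !inA // !side.
(* Faces with empty boundary would have charge $-8$. They are dropped, since a cut depends only on
   [J :&: I']. *)
pose I' := [set i | B i != set0].
have cardZ : #|cycle_space A| <= 2 ^ #|I'|.
  rewrite -card_powerset.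
  pose f (J : {set I}) := [set E in A | (l E \in J) (+) (r E \in J)].
  apply: leq_trans (leq_imset_card f _); apply: subset_leq_card; apply/subsetP => z.
  case/cycle_cut=> J ->; apply/imsetP; exists (J :&: I').
    by rewrite powersetE subsetIr.
  apply/setP => E; rewrite !inE; case EA: (E \in A) => //=.
  have [->|ne] := eqVneq (l E) (r E); first by rewrite !addbb.
  have El : E \in B (l E) by rewrite inE EA eqxx eq_sym (negPf ne).
  have Er : E \in B (r E) by rewrite inE EA eqxx (negPf ne).
  have [-> ->] : B (l E) != set0 /\ B (r E) != set0 by split; apply/set0Pn; exists E.
  by rewrite !andbT.
apply: leq_trans (leq_pexp2l (isT : 0 < 2) (_ : 2 * #|I'| <= #|A|)).
  by rewrite mulnC expnM leq_exp2r.
(* The triangular face [i] receives 1 through [E] from a face of length at least 5; [give] is the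
   same transfer seen from the giving face. *)
pose recv E i := [&& E \in B i, #|B i| == 3 & 4 < #|B (oth E i)|].
pose give E i := [&& E \in B i, 4 < #|B i| & #|B (oth E i)| == 3].
have swap : \sum_i \sum_(E in A) recv E i = \sum_i \sum_(E in A) give E i.
  rewrite exchange_big [RHS]exchange_big; apply: eq_bigr => E _ /=.
  rewrite (reindex_inj (inv_inj (othK E))); apply: eq_bigr => i _.
  by rewrite /recv /give Both othK; case: (E \in B i) => //=; rewrite andbC.
have total : \sum_i #|B i| <= 2 * #|A|.
  rewrite mulnC -sum_nat_const.
  under eq_bigr do rewrite -sum1_card (eq_bigl _ _ (fun E => in_set _ _)) /= big_mkcondr /=.
  rewrite exchange_big /=; apply: leq_sum => E EA.
  apply: (@leq_trans (\sum_i ((i == l E) + (i == r E)))).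
    by apply: leq_sum => i _; rewrite ![i == _]eq_sym; do 2!case: eqP.
  rewrite big_split /= (bigD1 (l E)) //= [X in _ + X](bigD1 (r E)) //= !eqxx.
  by rewrite !big1 // => i /negPf->.
(* The final charge of a face is nonnegative, written without subtraction. *)
have local i : i \in I' -> 8 + \sum_(E in A) give E i <= 2 * #|B i| + \sum_(E in A) recv E i.
  rewrite inE => Bi0.
  have B3 := cycle_card_ge3 e_sym e_irr (BZ i) Bi0.
  have sumB (P : pred {set T}) :
      \sum_(E in A) (E \in B i) && P E = #|[set E in B i | P E]|.
    rewrite -sum1_card [RHS]big_mkcond [LHS]big_mkcond /=; apply: eq_bigr => E _.
    by rewrite !inE; case: (E \in A) => //=; case: (_ (+) _); case: (P E).
  have [t3|n3] := eqVneq #|B i| 3.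
    have -> : \sum_(E in A) give E i = 0.
      by apply: big1 => E _; rewrite /give t3 andbF.
    rewrite /recv t3 eqxx /= sumB.
    (* Two triangular faces sharing an edge would have the same boundary, whereas distinct faces
       share at most one edge. *)
    have E4 E : E \in B i -> 3 < #|B (oth E i)|.
      move=> Ei; have Eo : E \in B (oth E i) by rewrite Both.
      have o0 : B (oth E i) != set0 by apply/set0Pn; exists E.
      rewrite ltn_neqAle (cycle_card_ge3 e_sym e_irr (BZ _)) // andbT.
      apply/negP => /eqP o3.
      have [x xE] : exists x, x \in E.
        apply/set0Pn; rewrite -card_gt0 (edge_card e_irr) //.
        by move: Ei; rewrite inE => /andP[/(subsetP sA)].
      have eqB := triangles_meet (BZ i) (BZ _) t3 (esym o3) Ei Eo xE xE.
      have : #|B i| <= 1.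
        apply/card_le1_eqP => E1 E2 h1 h2.
        by apply: (Bsimple i (oth E i)); rewrite -?eqB // eq_sym BoN.
      by rewrite t3.
    (* All faces of length 4 beside this triangle have the same boundary, so at most one edge leads
       to such a face. The others, at least two, bring the missing charge: $2\cdot 3+2=8$. *)
    have : #|[set E in B i | #|B (oth E i)| == 4]| <= 1.
      apply/card_le1_eqP => E1 E2; rewrite !inE -!andbA.
      move=> /and3P[E1A E1i /eqP c1] /and3P[E2A E2i /eqP c2].
      have {E1A E1i}E1i : E1 \in B i by rewrite inE E1A.
      have {E2A E2i}E2i : E2 \in B i by rewrite inE E2A.
      have [E1o E2o] : E1 \in B (oth E1 i) /\ E2 \in B (oth E2 i) by rewrite !Both.
      have eqB := triangle_4cycle_unique (BZ i) (BZ _) (BZ _) t3 c1 c2 E1i E1o E2i E2o.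
      apply: (Bsimple i (oth E2 i)) => //; first by rewrite eq_sym BoN.
      by rewrite -eqB.
    have : #|B i| <= #|[set E in B i | #|B (oth E i)| == 4]|
                     + #|[set E in B i | 4 < #|B (oth E i)|]|.
      apply: leq_trans (leq_card_setU _ _); apply: subset_leq_card.
      apply/subsetP => E Ei; rewrite in_setU 2!in_set Ei /= [_ == 4]eq_sym -leq_eqVlt.
      exact: E4.
    move=> le3 le1; rewrite addn0 -[8]/(2 * 3 + 2) leq_add2l -(leq_add2l 1).
    by rewrite -[1 + 2]t3 (leq_trans le3) // leq_add2r.
  have -> : \sum_(E in A) recv E i = 0.
    by apply: big1 => E _; rewrite /recv (negPf n3) andbF.
  (* A face of length 4 has charge 0 and takes part in no transfer. *)
  have [g5|le4] := ltnP 4 #|B i|; last first.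
    have -> : \sum_(E in A) give E i = 0; last by move: B3 n3 le4; lia.
    by apply: big1 => E _; rewrite /give ltnNge le4 andbF.
  rewrite /give g5 /= sumB; set X := [set E in B i | _].
  have sX : X \subset B i by apply/subsetP => E; rewrite inE => /andP[].
  (* Two edges of [X] that meet would belong to one triangle, which shares a single edge with this
     face. So a face of length $l$ gives at most $\lfloor l/2\rfloor$, and this is at most $2l-8$
     for $l\ge 5$. *)
  have tX : trivIset X.
    apply/trivIsetP => E1 E2; rewrite /X [E1 \in _]in_set [E2 \in _]in_set.
    move=> /andP[E1i /eqP c1] /andP[E2i /eqP c2].
    apply: contraR => /pred0Pn[x /andP[/= x1 x2]]; apply/eqP.
    have [E1o E2o] : E1 \in B (oth E1 i) /\ E2 \in B (oth E2 i) by rewrite !Both.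
    have eqB := triangles_meet (BZ _) (BZ _) c1 c2 E1o E2o x1 x2.
    apply: (Bsimple i (oth E2 i)) => //; first by rewrite eq_sym BoN.
    by rewrite -eqB.
  have : 2 * #|X| <= #|B i|.
    apply: leq_trans (cycle_cover (BZ i)).
    have cX : cover X \subset cover (B i).
      by apply/bigcupsP => E EX; apply: bigcup_sup; apply: (subsetP sX).
    apply: leq_trans (subset_leq_card cX).
    rewrite -(eqP tX) mulnC -sum_nat_const; apply: leq_sum => E EX.
    by rewrite (edge_card e_irr) //; apply: (subsetP sA); move: EX; rewrite !inE => /andP[/andP[]].
  by move: g5; rewrite addn0; move: #|X| #|B i| => x b; lia.
have : 8 * #|I'| + \sum_i \sum_(E in A) give E i <= 2 * (2 * #|A|) + \sum_i \sum_(E in A) recv E i.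
  apply: (@leq_trans (2 * (\sum_i #|B i|) + \sum_i \sum_(E in A) recv E i)); last first.
    by rewrite leq_add2r leq_mul2l total.
  rewrite mulnC -sum_nat_const big_distrr /= [X in X + _ <= _]big_mkcond /= -!big_split /=.
  apply: leq_sum => i _; case: ifP => [/local//|]; rewrite inE => /negbFE/eqP B0.
  by rewrite big1 // => E _; rewrite /give B0 inE.
by rewrite swap; lia.
Qed.

(** Deleting two edges in series divides the left side by at most 4 and the right side by exactly 4,
    so induction reduces to the case without series pairs. *)
Lemma card_cycle_space_le A : (forall A', A' \subset edge_set e -> has_dual A') ->
  A \subset edge_set e -> #|cycle_space A| ^ 2 <= 2 ^ #|A|.
Proof.
move=> dual; have [n] := ubnP #|A|; elim: n A => // n IH A ltA sA.
pose series E1 E2 := [&& E1 \in A, E2 \in A, E1 != E2 &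
  [forall z in cycle_space A, (E1 \in z) == (E2 \in z)]].
have [/existsP[E1 /existsP[E2 /and4P[E1A E2A nE12 /forall_inP ser]]]|nser] :=
  boolP [exists E1, exists E2, series E1 E2].
  set A' := A :\ E1 :\ E2.
  have cA : #|A| = #|A'|.+2.
    by rewrite (cardsD1 E1) E1A (cardsD1 E2 (A :\ E1)) !inE eq_sym nE12 E2A.
  have leZ : #|cycle_space A| <= 2 * #|cycle_space A'|.
    by apply: card_cycle_space_series => // z /ser/eqP.
  have sub : A' \subset edge_set e.
    by apply: subset_trans sA; rewrite !subDset subsetU // subsetU ?subxx ?orbT.
  have := IH A' _ sub; rewrite cA in ltA *.
  move=> /(_ (ltnW ltA)) leA'.
  apply: leq_trans (_ : (2 * #|cycle_space A'|) ^ 2 <= _).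
    by rewrite leq_exp2r.
  have -> : 2 ^ #|A'|.+2 = 2 ^ 2 * 2 ^ #|A'| by rewrite -expnD.
  by rewrite expnMn leq_mul2l leA'.
apply: no_series_card => //; first exact: dual.
move=> E1 E2 E1A E2A ser; apply/eqP; apply: contraNT nser => ne.
apply/existsP; exists E1; apply/existsP; exists E2.
by rewrite /series E1A E2A ne; apply/forall_inP => z /ser->.
Qed.

(** In terms of the dimension $d$ of the cycle space, $|A|-|S|\le d\le |A|/2$; the computation is
    done on powers of 2. *)
Lemma dual_sparse (S : {set T}) : (forall A, A \subset edge_set e -> has_dual A) ->
  #|[set E in edge_set e | E \subset S]| <= 2 * #|S|.
Proof.
move=> dual; set A := [set E in _ | _].
have sA : A \subset edge_set e by apply/subsetP => E; rewrite inE => /andP[].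
have le1 := card_cycle_space_le dual sA.
have le2 : 2 ^ #|A| <= #|cycle_space A| * 2 ^ #|S|.
  by apply: card_cycle_space_ge => E; rewrite inE => /andP[].
rewrite -(leq_add2l #|A|) addnn -mul2n -(@leq_exp2l 2) // mulnC expnM expnD.
rewrite [2 * _]mulnC expnM.
apply: leq_trans (_ : (#|cycle_space A| * 2 ^ #|S|) ^ 2 <= _).
  by rewrite leq_exp2r.
by rewrite expnMn leq_mul2r le1 orbT.
Qed.
End Discharging.

(** * Minors of the square grid *)

Section Grid.
Implicit Types (p q x y : nat * nat) (b : bool) (i j : nat).

(** Reflexive, because consecutive cells of a discretised arc may coincide. *)
Definition grid_adj p q :=
  [|| p == q, q == (p.1.+1, p.2), q == (p.1, p.2.+1),
      p == (q.1.+1, q.2) | p == (q.1, q.2.+1)].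

Inductive grid_reach (C : pred (nat * nat)) (x : nat * nat) : nat * nat -> Prop :=
| grid_reach0 : C x -> grid_reach C x x
| grid_reachS y z : grid_reach C x y -> grid_adj y z -> C z -> grid_reach C x z.

(** [C u] is the branch set of [u] and [rho u] its root. Connectedness is only asked between the
    root and the cells where edges leave. Positive coordinates keep the branch sets where [boundary]
    is meaningful. *)
Definition grid_minor (T : finType) (e : rel T) :=
  exists (n : nat) (C : T -> pred (nat * nat)) (rho : T -> nat * nat),
  [/\ forall u p, C u p -> (0 < p.1 < n) && (0 < p.2 < n),
      forall u v p, C u p -> C v p -> u = v &
      forall u v, e u v -> exists x y,
        [/\ grid_reach (C u) (rho u) x, grid_adj x y & grid_reach (C v) (rho v) y]].

(* The grid edge [(b, i, j)] joins [(i, j)] to its right ([b]) or upper neighbour;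
   the pixel [(i, j)] is the unit square whose lower left corner is [(i, j)]. *)
Definition gtail (b : bool) i j : nat * nat := (i, j).
Definition ghead (b : bool) i j : nat * nat := if b then (i.+1, j) else (i, j.+1).
(** The pixel separated from the pixel $(i,j)$ by the grid edge $(b,i,j)$: the one below or to the
    left. *)
Definition gside (b : bool) i j : nat * nat := if b then (i, j.-1) else (i.-1, j).

Definition chain := bool -> nat -> nat -> bool.

(* Meaningful for [0 < i] and [0 < j] only. *)
Definition boundary (g : chain) i j :=
  g true i j (+) g true i.-1 j (+) (g false i j (+) g false i j.-1).

Definition addc (g h : chain) : chain := fun b i j => g b i j (+) h b i j.

Definition edge1 (b0 : bool) (i0 j0 : nat) : chain :=
  fun b i j => [&& b == b0, i == i0 & j == j0].

Lemma boundary_addc g h i j :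
  boundary (addc g h) i j = boundary g i j (+) boundary h i j.
Proof.
rewrite /boundary /addc.
by do 4![case: (g _ _ _)]; do 4![case: (h _ _ _)].
Qed.

Lemma boundary_edge1 b i0 j0 i j : 0 < i -> 0 < j ->
  boundary (edge1 b i0 j0) i j = ((i, j) == gtail b i0 j0) (+) ((i, j) == ghead b i0 j0).
Proof.
case: i j => [|i] [|j] // _ _; rewrite /boundary /edge1 /gtail /ghead /=.
by case: b => /=; rewrite !xpair_eqE ?eqSS ?addbF.
Qed.

Lemma grid_adj_edge x y : grid_adj x y -> x = y \/ exists b i j,
  (x, y) = (gtail b i j, ghead b i j) \/ (x, y) = (ghead b i j, gtail b i j).
Proof.
case: x y => [x1 x2] [y1 y2] /or4P[/eqP->|/eqP->|/eqP->|/orP[]/eqP->]; first by left.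
- by right; exists true, x1, x2; left.
- by right; exists false, x1, x2; left.
- by right; exists true, y1, y2; right.
- by right; exists false, y1, y2; right.
Qed.

Lemma grid_reach_in C x y : grid_reach C x y -> C y.
Proof. by case. Qed.

(** The sum modulo 2 of the grid edges along the path, whose boundary telescopes. *)
Lemma grid_reach_chain (C : pred (nat * nat)) x y : grid_reach C x y -> exists g : chain,
  (forall b i j, g b i j -> C (gtail b i j) && C (ghead b i j)) /\
  (forall i j, 0 < i -> 0 < j -> boundary g i j = ((i, j) == x) (+) ((i, j) == y)).
Proof.
elim=> [Cx|{}y z xy [g [gC gb]] yz Cz].
  exists (fun _ _ _ => false); split=> // i j _ _; by rewrite addbb.
have [<-|[b [i0 [j0 yzE]]]] := grid_adj_edge yz; first by exists g.
have Cy := grid_reach_in xy.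
exists (addc g (edge1 b i0 j0)); split.
  move=> b' i j; rewrite /addc; case gij: (g b' i j) => /=.
    by move=> _; apply: gC.
  case/and3P=> /eqP-> /eqP-> /eqP->.
  by case: yzE => [] [<- <-]; rewrite Cy Cz.
move=> i j i0' j0'; rewrite boundary_addc gb // boundary_edge1 //.
by case: yzE => [] [<- <-]; rewrite -!addbA; congr (_ (+) _);
  case: (_ == y); case: (_ == z).
Qed.

Lemma big_addb_odd (I : finType) (P F : pred I) :
  \big[addb/false]_(i | P i) F i = odd #|[set i | P i & F i]|.
Proof.
rewrite -sum1_card (big_morph odd oddD (erefl _)) /= big_mkcond [RHS]big_mkcond /=.
by apply: eq_bigr => i _; rewrite inE; case: (P i); case: (F i).
Qed.

(* Discrete Stokes formula. *)
Lemma sum_boundary n (P : nat -> nat -> bool) (g : chain) :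
  (forall i j, P i j -> (0 < i < n) && (0 < j < n)) ->
  \big[addb/false]_(i < n) \big[addb/false]_(j < n) (P i j && boundary g i j) =
  \big[addb/false]_(i < n) \big[addb/false]_(j < n)
    ((g true i j && (P i j (+) P i.+1 j)) (+) (g false i j && (P i j (+) P i j.+1))).
Proof.
move=> Pn.
have P0j j : P 0 j = false by apply/negP => /Pn.
have Pi0 i : P i 0 = false by apply/negP => /Pn; rewrite andbC.
have Pnj j : P n j = false by apply/negP => /Pn; rewrite ltnn andbF.
have Pin i : P i n = false by apply/negP => /Pn; rewrite ltnn !andbF.
(* Summation by parts: no term is lost since [P] vanishes at $0$ and at $n$. *)
have shift (F : nat -> bool) (G : nat -> bool) : G 0 = false -> G n = false ->
    \big[addb/false]_(i < n) (G i && F i.-1) = \big[addb/false]_(i < n) (G i.+1 && F i).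
  move=> G0 Gn; case: n Gn {Pn Pnj Pin} => [|m] Gn; first by rewrite !big_ord0.
  rewrite big_ord_recl [RHS]big_ord_recr /= G0 Gn /= addbF.
  by apply: eq_bigr.
transitivity (\big[addb/false]_(i < n) \big[addb/false]_(j < n)
    ((g true i j && P i j) (+) (P i j && g true i.-1 j) (+)
     ((g false i j && P i j) (+) (P i j && g false i j.-1)))).
  apply: eq_bigr => i _; apply: eq_bigr => j _; rewrite /boundary.
  by case: (P i j); rewrite ?andbT ?andbF.
transitivity (\big[addb/false]_(i < n) \big[addb/false]_(j < n)
    ((g true i j && P i j) (+) (P i.+1 j && g true i j) (+)
     ((g false i j && P i j) (+) (P i j.+1 && g false i j)))); last first.
  apply: eq_bigr => i _; apply: eq_bigr => j _.
  by rewrite !andb_addr ![P _ _ && g _ _ _]andbC.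
under eq_bigr do rewrite !big_split /=.
under [RHS]eq_bigr do rewrite !big_split /=.
rewrite !big_split /=; congr (_ (+) _ (+) (_ (+) _)).
  rewrite exchange_big [RHS]exchange_big /=; apply: eq_bigr => j _.
  by rewrite (shift (fun i => g true i j) (fun i => P i j)).
apply: eq_bigr => i _.
by rewrite (shift (fun j => g false i j) (fun j => P i j)).
Qed.
End Grid.

(** * The dual graph of a grid minor *)

Section GridDual.
Variables (T : finType) (e : rel T).
Hypotheses (e_sym : symmetric e) (e_irr : irreflexive e).

(* Lifting an edge of the minor to a path of the grid between the two roots;
   [d] is the only grid edge of this path that leaves the branch sets. *)
Lemma edge_lift (C : T -> pred (nat * nat)) (rho : T -> nat * nat) (E : {set T}) :
  (forall u v p, C u p -> C v p -> u = v) ->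
  (forall u v, e u v -> exists x y,
        [/\ grid_reach (C u) (rho u) x, grid_adj x y & grid_reach (C v) (rho v) y]) ->
  E \in edge_set e ->
  exists d : (bool * (nat * nat)) * chain, let: (b, (i, j)) := d.1 in
  [/\ exists u v, [/\ E = [set u; v], e u v, C u (gtail b i j) & C v (ghead b i j)],
      forall b' i' j', d.2 b' i' j' ->
        (b', (i', j')) = d.1 \/ exists u, C u (gtail b' i' j') && C u (ghead b' i' j'),
      d.2 b i j &
      forall i' j', 0 < i' -> 0 < j' ->
        boundary d.2 i' j' = \big[addb/false]_(u in E) ((i', j') == rho u)].
Proof.
move=> disj conn /edge_setP[u [v [uv ->]]].
have nuv : u != v by apply: contraTneq uv => ->; rewrite e_irr.
have [x [y [rx xy ry]]] := conn u v uv.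
have [Cx Cy] := (grid_reach_in rx, grid_reach_in ry).
have [gu [guC gub]] := grid_reach_chain rx.
have [gv [gvC gvb]] := grid_reach_chain ry.
case: (grid_adj_edge xy) => [xyE|[b [i [j xyE]]]].
  by case/eqP: nuv; apply: disj Cx _; rewrite xyE.
have nC w : C w (gtail b i j) && C w (ghead b i j) = false.
  apply/negP => /andP[wt wh]; case/eqP: nuv.
  by case: xyE Cx Cy => [] [-> ->] Cx Cy;
    [rewrite -(disj _ _ _ wt Cx)|rewrite -(disj _ _ _ wh Cx)]; [apply: disj wh _|apply: disj wt _].
exists ((b, (i, j)), addc (addc gu gv) (edge1 b i j)) => /=; split.
- case: xyE Cx Cy => [] [-> ->] Cx Cy; first by exists u, v.
  by exists v, u; rewrite setUC e_sym.
- move=> b' i' j'; rewrite /addc /edge1.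
  case gu': (gu b' i' j'); first by right; exists u; apply: guC.
  case gv': (gv b' i' j'); first by right; exists v; apply: gvC.
  by case/and3P=> /eqP-> /eqP-> /eqP->; left.
- rewrite /addc /edge1 !eqxx; case gu': (gu b i j); first by move/guC: gu'; rewrite nC.
  by case gv': (gv b i j) => //; move/gvC: gv'; rewrite nC.
move=> i' j' i'0 j'0; rewrite !boundary_addc gub // gvb // boundary_edge1 //.
rewrite big_setU1 ?inE // big_set1.
by case: xyE => [] [<- <-]; case: (_ == rho u); case: (_ == rho v);
  case: (_ == x); case: (_ == y).
Qed.

(** Cuts are cycles by the Stokes formula on each branch set; cycles are cuts because a closed chain
    of the grid separates the pixels inside it from those outside. *)
Lemma grid_minor_dual (A : {set {set T}}) :
  grid_minor e -> A \subset edge_set e -> has_dual A.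
Proof.
move=> [n [C [rho [Cn disj conn]]]] sA.
have /boolp.choice[dg dgP] (E : {set T}) : exists d : (bool * (nat * nat)) * chain,
    E \in A -> let: (b, (i, j)) := d.1 in
  [/\ exists u v, [/\ E = [set u; v], e u v, C u (gtail b i j) & C v (ghead b i j)],
      forall b' i' j', d.2 b' i' j' ->
        (b', (i', j')) = d.1 \/ exists u, C u (gtail b' i' j') && C u (ghead b' i' j'),
      d.2 b i j &
      forall i' j', 0 < i' -> 0 < j' ->
        boundary d.2 i' j' = \big[addb/false]_(u in E) ((i', j') == rho u)].
  have [/(subsetP sA) EA|_] := boolP (E \in A).
    by have [d dP] := edge_lift disj conn EA; exists d.
  by exists ((true, (0, 0)), fun _ _ _ => false).
pose gb E := (dg E).1.1; pose gi E := (dg E).1.2.1; pose gj E := (dg E).1.2.2.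
pose ga E : chain := (dg E).2.
have own E : E \in A -> exists u v, [/\ E = [set u; v], e u v,
    C u (gtail (gb E) (gi E) (gj E)) & C v (ghead (gb E) (gi E) (gj E))].
  by rewrite /gb /gi /gj => /dgP; case: (dg E) => [[b [i j]] g] [].
have ga_supp E b i j : E \in A -> ga E b i j ->
    (b, (i, j)) = (gb E, (gi E, gj E)) \/ exists u, C u (gtail b i j) && C u (ghead b i j).
  by rewrite /gb /gi /gj /ga => /dgP; case: (dg E) => [[b' [i' j']] g] [] /= _ + _ _; apply.
have ga_own E : E \in A -> ga E (gb E) (gi E) (gj E).
  by rewrite /gb /gi /gj /ga => /dgP; case: (dg E) => [[b [i j]] g] [].
have ga_bd E i j : E \in A -> 0 < i -> 0 < j ->
    boundary (ga E) i j = \big[addb/false]_(u in E) ((i, j) == rho u).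
  by rewrite /ga => /dgP; case: (dg E) => [[b' [i' j']] g] [] /= _ _ _; apply.
have nsame E w : E \in A -> C w (gtail (gb E) (gi E) (gj E)) &&
    C w (ghead (gb E) (gi E) (gj E)) = false.
  move=> /own[u [v [_ uv Cu Cv]]]; apply/negP => /andP[wu wv].
  by move: uv; rewrite (disj _ _ _ Cu wu) (disj _ _ _ Cv wv) e_irr.
have g_inj E1 E2 : E1 \in A -> E2 \in A -> gb E1 = gb E2 -> gi E1 = gi E2 ->
    gj E1 = gj E2 -> E1 = E2.
  move=> /own[u [v [-> _ Cu Cv]]] /own[u' [v' [-> _ Cu' Cv']]] eb ei ej.
  by rewrite eb ei ej in Cu Cv; rewrite (disj _ _ _ Cu Cu') (disj _ _ _ Cv Cv').
have g_n E : E \in A -> (0 < gi E < n.+1) && (0 < gj E < n.+1).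
  move=> /own[u [v [_ _ /Cn /andP[/andP[i0 i1] /andP[j0 j1]] _]]].
  by rewrite i0 j0 (leqW i1) (leqW j1).
(* Grid edges used by the minor: those inside a branch set and those representing an edge of [A].
   Faces are formed by joining pixels across all the others. *)
pose inM b i j := [exists u, C u (gtail b i j) && C u (ghead b i j)] ||
  [exists E in A, (b, (i, j)) == (gb E, (gi E, gj E))].
have inMn b i j : inM b i j -> (0 < i) && (0 < j).
  case/orP => [/existsP[u /andP[/Cn /andP[/andP[i0 _] /andP[j0 _]] _]]|].
    by rewrite i0.
  by case/exists_inP=> E /g_n + /eqP[_ -> ->]; case/andP=> /andP[-> _] /andP[-> _].
pose pix := ('I_n.+1 * 'I_n.+1)%type.
pose px (p : nat * nat) : pix := (inord p.1, inord p.2).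
pose prel (p q : pix) := [exists g : bool * pix,
  ~~ inM g.1 g.2.1 g.2.2 && ([set p; q] == [set px (gside g.1 g.2.1 g.2.2); g.2])].
have prel_sym : connect_sym prel.
  by apply: sym_connect_sym => p q; rewrite /prel setUC.
pose rt p := fingraph.root prel (px p).
have rt_side b i j : i < n.+1 -> j < n.+1 -> ~~ inM b i j -> rt (gside b i j) = rt (i, j).
  move=> ilt jlt nM; apply/(fingraph.rootP prel_sym)/connect1/existsP.
  by exists (b, px (i, j)); rewrite /= !inordK // nM eqxx.
exists pix, (fun E => rt (gside (gb E) (gi E) (gj E))), (fun E => rt (gi E, gj E)); split.
  move=> J; set z := [set E in A | _].
  (* [dlt] collects the grid edges with exactly one side in [J]. Around a grid point each of the
     four pixels counts twice, so its boundary vanishes, and evenly many of its edges leave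
     [C u]. *)
  pose dlt : chain := fun b i j => (rt (gside b i j) \in J) (+) (rt (i, j) \in J).
  apply/cycle_spaceP; split=> [|u].
    by apply/subsetP => E; rewrite inE => /andP[].
  have Cu i j : C u (i, j) -> (0 < i < n.+1) && (0 < j < n.+1).
    by move=> /Cn /andP[/andP[i0 i1] /andP[j0 j1]]; rewrite i0 j0 (leqW i1) (leqW j1).
  have := @sum_boundary n.+1 (fun i j => C u (i, j)) dlt Cu.
  rewrite big1; last first.
    move=> i _; apply: big1 => j _; case Cij: (C u _) => //=.
    have /andP[/andP[]] := Cu _ _ Cij; rewrite /boundary /dlt /=.
    case: (nat_of_ord i) (nat_of_ord j) => [|i'] [|j'] //= _ _ _.
    by do 4!case: (rt _ \in J).
  rewrite pair_big /= => zero.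
  pose crossing (g : bool * pix) := dlt g.1 g.2.1 g.2.2 &&
    (C u (gtail g.1 g.2.1 g.2.2) (+) C u (ghead g.1 g.2.1 g.2.2)).
  have {zero} : ~~ odd #|[set g | crossing g]|.
    have := @big_addb_odd _ xpredT crossing.
    rewrite (eq_bigl (fun g => xpredT g.1 && xpredT g.2)) // -(pair_big xpredT xpredT (fun b q => crossing (b, q))) /=.
    rewrite big_bool /= -big_split /= => <-.
    by rewrite /crossing /= -zero.
  (* A grid edge of [dlt] is used by the minor; if it also leaves [C u], it lies in no branch set
     and so represents an edge of [z] at [u]. *)
  suff -> : [set g | crossing g] =
      [set (gb E, px (gi E, gj E)) | E in star z u].
    rewrite card_in_imset // => E1 E2; rewrite !inE -!andbA.
    move=> /and3P[E1A _ _] /and3P[E2A _ _] /= [eb /(congr1 val)/= ei /(congr1 val)/= ej].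
    have /andP[/andP[_ i1] /andP[_ j1]] := g_n _ E1A.
    have /andP[/andP[_ i2] /andP[_ j2]] := g_n _ E2A.
    by apply: g_inj => //; [move: ei|move: ej]; rewrite !inordK.
  apply/setP => -[b [i j]]; rewrite inE; apply/andP/imsetP => /=.
    move=> [dij Cij]; have : inM b i j.
      apply: contraTT dij => nM; rewrite /dlt rt_side ?addbb //; exact: ltn_ord.
    case/orP=> [/existsP[w /andP[wt wh]]|/exists_inP[E EA /eqP[Eb Ei Ej]]].
      case Cut: (C u _) Cij => /=; first by rewrite (disj _ _ _ Cut wt) wh.
      by move=> Cuh; rewrite (disj _ _ _ Cuh wh) wt in Cut.
    have [u1 [v1 [EE uv Cu1 Cv1]]] := own _ EA.
    exists E; last by rewrite -Eb -Ei -Ej /px /= !inord_val.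
    rewrite /dlt in dij; rewrite !inE EA -Eb -Ei -Ej dij EE !inE /=; rewrite -Eb -Ei -Ej in Cu1 Cv1.
    case Cut: (C u _) Cij => /=; first by rewrite (disj _ _ _ Cut Cu1) eqxx.
    by move=> Cuh; rewrite (disj _ _ _ Cuh Cv1) eqxx orbT.
  move=> [E]; rewrite !inE -!andbA => /and3P[EA dE uE] [-> -> ->] /=.
  have /andP[/andP[_ i1] /andP[_ j1]] := g_n _ EA; rewrite !inordK //; split=> //.
  have [u1 [v1 [EE uv Cu1 Cv1]]] := own _ EA; rewrite EE !inE in uE.
  have := nsame _ u EA.
  by case/orP: uE => /eqP->; rewrite ?Cu1 ?Cv1 /= ?andbT => ->.
move=> z zZ; have /cycle_spaceP[/subsetP zA zev] := zZ.
(* The closed grid chain obtained by lifting every edge of [z]. *)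
pose zt : chain := fun b i j => \big[addb/false]_(E in z) ga E b i j.
have zt_supp b i j : ~~ inM b i j -> zt b i j = false.
  move=> nM; apply: big1 => E Ez; apply/negP => gE; case/negP: nM; apply/orP.
  have [->|[u uC]] := ga_supp _ _ _ _ (zA _ Ez) gE.
    by right; apply/exists_inP; exists E; rewrite ?zA.
  by left; apply/existsP; exists u.
have zt_own E : E \in A -> zt (gb E) (gi E) (gj E) = (E \in z).
  move=> EA.
  have other E' : E' \in z -> E' != E -> ga E' (gb E) (gi E) (gj E) = false.
    move=> E'z ne; apply/negP => gE; have [[eb ei ej]|[u]] := ga_supp _ _ _ _ (zA _ E'z) gE.
      by case/eqP: ne; apply: g_inj => //; apply: zA.
    by rewrite nsame.
  have [Ez|Ez] := boolP (E \in z).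
    by rewrite /zt (bigD1 E) //= ga_own // big1 // => E' /andP[]; apply: other.
  by apply: big1 => E' E'z; apply: other => //; apply: contraNneq Ez => <-.
have zt_bd i j : 0 < i -> 0 < j -> boundary zt i j = false.
  move=> i0 j0; rewrite /boundary /zt -!big_split /=.
  transitivity (\big[addb/false]_(E in z) \big[addb/false]_(u in E) ((i, j) == rho u)).
    by apply: eq_bigr => E Ez; rewrite -ga_bd // zA.
  rewrite (exchange_big_dep xpredT) //=; apply: big1 => u _.
  rewrite big_addb_odd; case: ((i, j) == rho u); last first.
    by rewrite (_ : [set E | _ & _] = set0) ?cards0 //; apply/setP => E; rewrite !inE andbF.
  apply/negbTE; rewrite (_ : [set E | _ & _] = star z u) //.
  by apply/setP => E; rewrite !inE andbT.
(* Parity of the crossings of [zt] with the ray going left from the pixel $(i,j)$. *)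
pose c i j := \big[addb/false]_(k < i.+1) zt false k j.
(* Across a vertical grid edge this is the definition of [c]; across a horizontal one, induction
   along the row uses that [zt] is closed. *)
have c_side b i j : let p := gside b i j in c p.1 p.2 (+) c i j = zt b i j.
  have z0 b' i' j' : (i' == 0) || (j' == 0) -> zt b' i' j' = false.
    move=> ij0; apply: zt_supp; apply/negP => /inMn.
    by case/orP: ij0 => /eqP->; rewrite ?andbF.
  case: b => /=.
    case: j => [|j]; first by rewrite addbb z0 ?orbT.
    elim: i => [|i IH] /=; first by rewrite /c !big_ord_recr !big_ord0 /= !z0.
    have := zt_bd i.+1 j.+1 isT isT; rewrite /boundary /= -IH.
    rewrite /c ![\big[addb/false]_(k < i.+2) _]big_ord_recr /= -!/(c _ _).
    do 2![case: (c i _)]; do 2![case: (zt false _ _)]; by case: (zt true _ _).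
  case: i => [|i]; first by rewrite addbb z0.
  by rewrite /= {2}/c big_ord_recr /= -/(c _ _) addbA addbb.
pose J := [set p : pix | c p.1 p.2].
have gside_lt b i j : i < n.+1 -> j < n.+1 ->
    ((gside b i j).1 < n.+1) && ((gside b i j).2 < n.+1).
  move=> ilt jlt; case: b => /=; rewrite ?ilt ?jlt ?andbT.
    exact: leq_ltn_trans (leq_pred _) jlt.
  exact: leq_ltn_trans (leq_pred _) ilt.
have closedJ : closed prel (mem J).
  move=> p q /existsP[[b [i j]] /= /andP[nM /eqP pq]].
  have cc : c (px (gside b i j)).1 (px (gside b i j)).2 = c i j.
    have /andP[l1 l2] := gside_lt b i j (ltn_ord i) (ltn_ord j).
    have := c_side b i j; rewrite zt_supp // /px /= !inordK //.
    by case: (c _ _); case: (c _ _).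
  have := set21 p q; have := set22 p q; rewrite pq !inE.
  by do 2![case/orP => /eqP->]; rewrite ?cc.
have rtJ i j : i < n.+1 -> j < n.+1 -> (rt (i, j) \in J) = c i j.
  move=> ilt jlt; rewrite -(closed_connect closedJ (connect_root prel (px (i, j)))).
  by rewrite inE /= !inordK.
exists J; apply/setP => E; rewrite inE.
case EA: (E \in A) => /=; last by apply/negP => /zA; rewrite EA.
have /andP[/andP[_ i1] /andP[_ j1]] := g_n _ EA.
have /andP[gl1 gl2] := gside_lt (gb E) _ _ i1 j1.
by rewrite -zt_own // -c_side -!rtJ // -surjective_pairing.
Qed.
End GridDual.

(** * Discretising a planar drawing *)

From mathcomp Require Import all_classical all_reals all_analysis.
From mathcomp Require Import lra.
Import Order.TTheory GRing.Theory Num.Theory.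
Import numFieldNormedType.Exports.

Section Drawing.
Local Open Scope ring_scope.

(** * Compactness of the unit interval and of the unit square *)

Section Compactness.
Variable R : realType.
Implicit Types (eps s t : R).

Definition in01 t := 0 <= t <= 1.

(** Let $m$ be the supremum of the $x$ such that one [eps] serves on all of $[0,x]$. The local [eps]
    at $m$ carries this beyond $m$ unless $m=1$. *)
Lemma unit_itv_uniform (Q : R -> R -> Prop) :
  (forall eps eps' s, 0 < eps' -> eps' <= eps -> Q eps s -> Q eps' s) ->
  (forall t, in01 t -> exists2 eps, 0 < eps &
     forall s, in01 s -> t - eps < s -> s < t + eps -> Q eps s) ->
  exists2 eps, 0 < eps & forall s, in01 s -> Q eps s.
Proof.
move=> anti loc.
pose A := [set x | in01 x /\ exists2 eps, 0 < eps & forall s, 0 <= s <= x -> Q eps s]%classic.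
have A0 : A 0.
  split; first by rewrite /in01 lexx ler01.
  have [|eps e0 eQ] := loc 0; first by rewrite /in01 lexx ler01.
  by exists eps => // s s0; apply: eQ; rewrite /in01; lra.
have supA : has_sup A.
  by split; [exists 0|exists 1 => x [/andP[]]].
have m0 : 0 <= sup A by apply: sup_upper_bound.
have m1 : sup A <= 1 by apply: sup_le_ub => [|x [/andP[]]//]; exists 0.
have [|eps e0 eQ] := loc (sup A); first by rewrite /in01 m0 m1.
have [x [x01 [eps' e'0 e'Q]] xm] := sup_adherent e0 supA.
pose y := Num.min 1 (sup A + eps / 2).
have y1 : y <= 1 by rewrite /y ge_min lexx.
have y2 : y <= sup A + eps / 2 by rewrite /y ge_min lexx orbT.
have y0 : 0 <= y by rewrite /y le_min ler01 /=; lra.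
have yQ : exists2 eps, 0 < eps & forall s, 0 <= s <= y -> Q eps s.
  exists (Num.min eps eps'); first by rewrite lt_min e0.
  move=> s sy; have [sx|xs] := leP s x.
    by apply: anti (e'Q s _); rewrite ?lt_min ?e0 ?ge_min ?lexx ?orbT //; lra.
  by apply: anti (eQ s _ _ _); rewrite ?lt_min ?e0 ?ge_min ?lexx ?orbT //; rewrite /in01; lra.
have ym : y <= sup A by apply: sup_upper_bound => //; split=> //; rewrite /in01 y0 y1.
have yE : y = 1.
  by move: ym; rewrite /y /Num.min; case: ifP => //; lra.
by rewrite yE in yQ.
Qed.

(** Compactness in $t$ for fixed $s$ gives a strip around $s$; compactness in $s$ then concludes. *)
Lemma unit_square_uniform (Q : R -> R -> R -> Prop) :
  (forall eps eps' s t, 0 < eps' -> eps' <= eps -> Q eps s t -> Q eps' s t) ->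
  (forall s t, in01 s -> in01 t -> exists2 eps, 0 < eps &
     forall s' t', in01 s' -> in01 t' -> s - eps < s' -> s' < s + eps ->
       t - eps < t' -> t' < t + eps -> Q eps s' t') ->
  exists2 eps, 0 < eps & forall s t, in01 s -> in01 t -> Q eps s t.
Proof.
move=> anti loc.
have [|s s01|eps e0 eQ] := @unit_itv_uniform (fun eps s => forall t, in01 t -> Q eps s t).
- by move=> eps eps' s e0 le h t t01; apply: anti (h t t01).
- pose Q2 eps t := forall s', in01 s' -> s - eps < s' -> s' < s + eps -> Q eps s' t.
  have [|t t01|eps e0 eQ] := @unit_itv_uniform Q2.
  + move=> eps eps' t e0 le h s' s'01 l1 l2.
    by apply: anti (h _ _ _ _) => //; lra.
  + have [eps e0 eQ] := loc s t s01 t01.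
    by exists eps => // t' t'01 l1 l2 s' s'01 l3 l4; apply: eQ.
  by exists eps => // s' s'01 l1 l2 t t01; apply: eQ.
by exists eps => // s t s01 t01; apply: eQ.
Qed.

Lemma fin_uniform (I : finType) (Q : R -> I -> Prop) :
  (forall eps eps' i, 0 < eps' -> eps' <= eps -> Q eps i -> Q eps' i) ->
  (forall i, exists2 eps, 0 < eps & Q eps i) ->
  exists2 eps, 0 < eps & forall i, Q eps i.
Proof.
move=> anti loc.
suff [eps e0 eQ] : exists2 eps, 0 < eps & forall i, i \in enum I -> Q eps i.
  by exists eps => // i; apply: eQ; rewrite mem_enum.
elim: (enum I) => [|i s [eps e0 IH]]; first by exists 1.
have [eps' e'0 Qi] := loc i; exists (Num.min eps eps'); first by rewrite lt_min e0.
move=> j; rewrite inE => /orP[/eqP->|/IH Qj].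
  by apply: anti Qi; rewrite ?lt_min ?e0 ?ge_min ?lexx ?orbT.
by apply: anti Qj; rewrite ?lt_min ?e0 ?ge_min ?lexx ?orbT.
Qed.

(** Closeness in the sup norm, as linear inequalities fit for [lra]. *)
Definition sup_close (d : R) (p q : R * R) :=
  [&& p.1 - q.1 <= d, q.1 - p.1 <= d, p.2 - q.2 <= d & q.2 - p.2 <= d].

Lemma sup_close_sym d p q : sup_close d p q -> sup_close d q p.
Proof. by case/and4P=> *; apply/and4P; split. Qed.

Lemma sup_close_trans d1 d2 d p q r : sup_close d1 p q -> sup_close d2 q r -> d1 + d2 <= d ->
  sup_close d p r.
Proof. by case/and4P=> a b c e /and4P[a' b' c' e'] le; apply/and4P; split; lra. Qed.

Lemma sup_closeW d d' p q : sup_close d p q -> d <= d' -> sup_close d' p q.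
Proof. by case/and4P=> a b c e le; apply/and4P; split; lra. Qed.

Lemma neq_far p q : p <> q -> exists2 d, 0 < d & ~~ sup_close d p q.
Proof.
move=> pq; have : (p.1 != q.1) || (p.2 != q.2).
  by apply: contra_notT pq; rewrite negb_or !negbK; case: p q => ? ? [? ?] /= /andP[/eqP-> /eqP->].
clear pq; case/orP; rewrite neq_lt => /orP[] lt;
  [exists ((q.1 - p.1) / 2)|exists ((p.1 - q.1) / 2)|
   exists ((q.2 - p.2) / 2)|exists ((p.2 - q.2) / 2)];
  by [lra|apply/negP => /and4P[]; lra].
Qed.

Definition cont01 (f : R -> R * R) := forall t, in01 t -> forall eps, 0 < eps ->
  exists2 d, 0 < d & forall s, in01 s -> t - d < s -> s < t + d -> sup_close eps (f s) (f t).

Lemma within_cont01 (f : R -> R * R) :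
  {within @unit_itv R, continuous f}%classic -> cont01 f.
Proof.
move=> /subspace_continuousP cf t t01 eps e0.
have /cvg_ballP/(_ eps e0) := cf t t01.
rewrite near_withinE => /nbhs_ballP[d /= d0 dP].
exists d => // s s01 l1 l2.
have := dP s; rewrite /ball /= ltr_distlC => /(_ _ s01).
case; first by rewrite l1 l2.
rewrite /ball /= !ltr_distlC => /andP[a b] /andP[a' b'].
by apply/and4P; split; lra.
Qed.

Lemma cont01_uniform f eps : cont01 f -> 0 < eps -> exists2 d, 0 < d &
  forall s t, in01 s -> in01 t -> s - t <= d -> t - s <= d -> sup_close eps (f s) (f t).
Proof.
move=> cf e0.
pose Q d s t := s - t <= d -> t - s <= d -> sup_close eps (f s) (f t).
apply: (@unit_square_uniform Q).
  by move=> d d' s t _ le h l1 l2; apply: h; lra.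
move=> s t s01 t01; have [st|st|<-] := ltgtP s t.
(* Off the diagonal the claim is vacuous: the nearby parameters differ by more than this [eps]. *)
- by exists ((t - s) / 4); [lra|move=> s' t' *; rewrite /Q; lra].
- by exists ((s - t) / 4); [lra|move=> s' t' *; rewrite /Q; lra].
have [d d0 dP] := cf s s01 (eps / 2) ltac:(lra).
exists d => // s' t' s'01 t'01 l1 l2 l3 l4 _ _.
by apply: sup_close_trans (dP s' _ _ _) (sup_close_sym (dP t' _ _ _)) _ => //; lra.
Qed.

(** The bound is an inverse so that the property passes to smaller [d], as [unit_itv_uniform]
    requires. *)
Lemma cont01_bounded f : cont01 f -> exists2 d, 0 < d &
  forall t, in01 t -> sup_close d^-1 (f t) (0, 0).
Proof.
move=> cf; apply: (@unit_itv_uniform (fun d t => sup_close d^-1 (f t) (0, 0))).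
  move=> d d' s d'0 le h; apply: sup_closeW h _.
  by rewrite lef_pV2 // posrE; lra.
move=> t t01; have [d d0 dP] := cf t t01 1 ltr01.
pose m := `|(f t).1| + `|(f t).2| + 1.
have [n1 n2] : `|(f t).1| >= 0 /\ `|(f t).2| >= 0 by [].
have m0 : 0 < m by rewrite /m; lra.
exists (Num.min d m^-1); first by rewrite lt_min d0 invr_gt0.
move=> s s01 l1 l2.
have lm : Num.min d m^-1 <= d by rewrite ge_min lexx.
have fs : sup_close 1 (f s) (f t) by apply: dP => //; lra.
have le : m <= (Num.min d m^-1)^-1.
  by rewrite -[leLHS]invrK lef_pV2 ?posrE ?lt_min ?invr_gt0 ?d0 ?m0 // ge_min lexx orbT.
apply: sup_closeW le; case/and4P: fs => a b c e.
have [[[f1 f2] f3] f4] := (ler_norm (f t).1, ler_norm (f t).2, ler_norm (- (f t).1), ler_norm (- (f t).2)).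
rewrite !normrN in f3 f4; rewrite /m.
by apply/and4P; split=> /=; lra.
Qed.
End Compactness.

(** * Squares and walks in the grid *)

Definition grid_square (k : nat) (c p : nat * nat) : bool :=
  [&& p.1 <= c.1 + k, c.1 <= p.1 + k, p.2 <= c.2 + k & c.2 <= p.2 + k]%N.

(** Induction on the distance to the centre: move towards it horizontally, then vertically, staying
    in the square. *)
Lemma grid_square_reach k c (C : pred (nat * nat)) :
  (forall p, grid_square k c p -> C p) ->
  forall p, grid_square k c p -> grid_reach C c p.
Proof.
move=> sub p; have [m] := ubnP ((p.1 - c.1) + (c.1 - p.1) + (p.2 - c.2) + (c.2 - p.2))%N.
elim: m p => // m IH [p1 p2] /= lt sq; have Cp := sub _ sq; move: sq; rewrite /grid_square /=.
case: c sub lt IH => c1 c2 /= sub lt IH sq.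
have step q : grid_square k (c1, c2) q -> grid_adj q (p1, p2) ->
    ((q.1 - c1) + (c1 - q.1) + (q.2 - c2) + (c2 - q.2) < m)%N ->
    grid_reach C (c1, c2) (p1, p2).
  by move=> sq' adj lt'; apply: grid_reachS adj Cp; apply: IH.
have [l1|l1|e1] := ltngtP p1 c1.
- by apply: (step (p1.+1, p2)); rewrite /grid_adj /grid_square /= ?eqxx ?orbT //; lia.
- apply: (step (p1.-1, p2)); rewrite /grid_adj /grid_square /= ?prednK ?eqxx ?orbT //; lia.
have [l2|l2|e2] := ltngtP p2 c2.
- by apply: (step (p1, p2.+1)); rewrite /grid_adj /grid_square /= ?eqxx ?orbT //; lia.
- apply: (step (p1, p2.-1)); rewrite /grid_adj /grid_square /= ?prednK ?eqxx ?orbT //; lia.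
by rewrite -e1 -e2; apply: grid_reach0.
Qed.

(** Take for [b] the first visit to [Q] and for [a] the last visit to [P] before it. *)
Lemma walk_exit (X : Type) (w : nat -> X) (P Q : pred X) m :
  P (w 0%N) -> Q (w m) -> (forall x, P x -> Q x -> False) ->
  exists a b, [/\ (a < b <= m)%N, P (w a), Q (w b) &
    forall i, (a < i < b)%N -> ~~ P (w i) /\ ~~ Q (w i)].
Proof.
move=> P0 Qm PQ.
have exQ : exists i, Q (w i) by exists m.
case: (ex_minnP exQ) => b Qb bmin.
have b0 : (0 < b)%N by case: b Qb {bmin} => // /PQ; case.
have exP : exists i, (i < b)%N && P (w i) by exists 0%N; rewrite b0.
have bnd i : (i < b)%N && P (w i) -> (i <= b)%N by case/andP=> /ltnW.
case: (ex_maxnP exP bnd) => a /andP[ab Pa] amax.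
exists a, b; split=> //; first by rewrite ab bmin.
move=> i /andP[ai ib]; split; apply/negP => h.
  by have := amax i; rewrite ib h leqNgt ai => /(_ isT).
by have := bmin i h; rewrite leqNgt ib.
Qed.

(** Between its last cell in [Su] and its first in [Sv] the walk stays in [Cu]; its step into [Sv]
    is the connecting grid edge. *)
Lemma walk_branch (w : nat -> nat * nat) (Su Sv Cu Cv : pred (nat * nat)) cu cv m :
  (forall p, Su p -> grid_reach Cu cu p) -> (forall p, Sv p -> grid_reach Cv cv p) ->
  Su (w 0%N) -> Sv (w m) -> (forall p, Su p -> Sv p -> False) ->
  (forall i, (i < m)%N -> grid_adj (w i) (w i.+1)) ->
  (forall i, (i <= m)%N -> ~~ Su (w i) -> ~~ Sv (w i) -> Cu (w i)) ->
  exists x y, [/\ grid_reach Cu cu x, grid_adj x y & grid_reach Cv cv y].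
Proof.
move=> ru rv S0 Sm dis adj mid.
have [a [b [/andP[ab bm] Sa Sb abP]]] := walk_exit S0 Sm dis.
have reach i : (a + i < b)%N -> grid_reach Cu cu (w (a + i)%N).
  elim: i => [|i IH] ib; first by rewrite addn0; apply: ru.
  rewrite addnS in ib *.
  apply: grid_reachS (IH (ltnW ib)) (adj _ _) _; first by lia.
  have [|nu nv] := abP (a + i).+1; first by lia.
  by apply: mid => //; lia.
exists (w b.-1), (w b); split; last exact: rv.
  have -> : b.-1 = (a + (b.-1 - a))%N by lia.
  by apply: reach; lia.
by case: b ab bm {Sb abP reach} => // b _ bm; apply: adj.
Qed.

Lemma grid_adj_l a b c : (a <= b.+1)%N -> (b <= a.+1)%N -> grid_adj (a, c) (b, c).
Proof.
move=> h1 h2; rewrite /grid_adj /= !xpair_eqE !eqxx !andbT.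
have [//|] := eqVneq a b.
move=> ne; have [->|->] : a = b.+1 \/ b = a.+1 by lia.
  by rewrite !eqxx ?orbT.
by rewrite !eqxx ?orbT.
Qed.

Lemma grid_adj_r a b c : (a <= b.+1)%N -> (b <= a.+1)%N -> grid_adj (c, a) (c, b).
Proof.
move=> h1 h2; rewrite /grid_adj /= !xpair_eqE !eqxx /=.
have [//|] := eqVneq a b.
move=> ne; have [->|->] : a = b.+1 \/ b = a.+1 by lia.
  by rewrite !eqxx ?orbT.
by rewrite !eqxx ?orbT.
Qed.

Lemma truncn_step (R : realType) (a b : R) : 0 <= a -> 0 <= b -> a - b <= 1 ->
  (Num.truncn a <= (Num.truncn b).+1)%N.
Proof.
move=> a0 b0 ab; have /andP[a1 _] := truncn_itv a0; have /andP[_ b1] := truncn_itv b0.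
rewrite -ltnS -(ltr_nat R) mulrSr; lra.
Qed.

(** * From a drawing separated at unit scale to a grid minor *)

Definition in_box (R : realType) (lo hi : R) (p : R * R) :=
  [/\ lo <= p.1, p.1 <= hi, lo <= p.2 & p.2 <= hi].

(* Around each vertex [u] a square [S u] of grid cells is reserved; the branch set
   of [u] is [S u] together with the cells along the arcs leaving [u] towards
   vertices of higher rank, outside the squares of both ends. *)
Lemma unit_mesh_grid_minor (R : realType) (T : finType) (e : rel T)
    (pos : T -> R * R) (arc : T -> T -> R -> R * R) (r M : R) (N : nat) :
  symmetric e -> irreflexive e -> 10 <= r -> (0 < N)%N ->
  (forall u, in_box (r + 10) M (pos u)) ->
  (forall u v t, e u v -> in01 t -> in_box (r + 10) M (arc u v t)) ->
  (forall u v, e u v -> arc u v 0 = pos u) ->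
  (forall u v, e u v -> arc u v 1 = pos v) ->
  (forall u v, u != v -> ~~ sup_close (8 * r) (pos u) (pos v)) ->
  (forall u v w t, e u v -> in01 t -> w != u -> w != v ->
    ~~ sup_close (8 * r) (arc u v t) (pos w)) ->
  (forall u v x y s t, e u v -> e x y ->
    [set u; v]%SET != [set x; y]%SET -> in01 s -> in01 t ->
    ~~ sup_close r (arc u v s) (pos u) -> ~~ sup_close r (arc u v s) (pos v) ->
    ~~ sup_close 4 (arc u v s) (arc x y t)) ->
  (forall u v m, e u v -> (m < N)%N ->
    sup_close 1 (arc u v (m%:R / N%:R)) (arc u v (m.+1%:R / N%:R))) ->
  grid_minor e.
Proof.
move=> e_sym e_irr r_ge N_gt0 pos_bd arc_bd arc0 arc1 pos_sep arc_pos_sep arc_sep arc_step.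
(* The margin over $r$ absorbs rounding: if a cell outside [S u] is within 2 of a point, this point
   is farther than $r$ from [pos u]. *)
pose k := (Num.truncn r).+4.
pose cell (p : R * R) : nat * nat := (Num.truncn p.1, Num.truncn p.2).
pose corner (p : nat * nat) : R * R := (p.1%:R, p.2%:R).
have kr : r + 3 <= k%:R <= r + 4.
  have /andP[h1] : (Num.truncn r)%:R <= r < (Num.truncn r).+1%:R by apply: truncn_itv; lra.
  by rewrite /k !mulrSr => h2; lra.
have cell_close p : in_box (r + 10) M p -> sup_close 1 (corner (cell p)) p.
  move=> [h1 _ h2 _]; rewrite /corner /cell /=.
  have /andP[] := @truncn_itv R p.1 ltac:(lra).
  have /andP[] := @truncn_itv R p.2 ltac:(lra).
  by rewrite !mulrSr => a b c d; apply/and4P; split=> /=; lra.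
pose S u := grid_square k (cell (pos u)).
(* The tolerance 2 is 1 for rounding plus 1 for a time step, since the walk [w] reads its two
   coordinates at different times. *)
pose near u v p := `[< exists2 t, in01 t & sup_close 2 (corner p) (arc u v t) >].
(* The arcs [arc u v] and [arc v u] may be unrelated; only the one leaving the end of lower rank is
   used. *)
pose ori u v := e u v && (enum_rank u < enum_rank v)%N.
pose C u : pred (nat * nat) := fun p =>
  S u p || [exists v, [&& ori u v, near u v p, ~~ S u p & ~~ S v p]].
have S_close u p : S u p -> sup_close (k%:R + 1) (corner p) (pos u).
  rewrite /S /grid_square -!(ler_nat R) !natrD => /and4P[a b c d].
  have /and4P[/= a' b' c' d'] := cell_close _ (pos_bd u).
  by apply/and4P; split=> /=; lra.
have close_S u p : sup_close (r + 2) (corner p) (pos u) -> S u p.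
  rewrite /S /grid_square -!(ler_nat R) !natrD => /and4P[/= a b c d].
  have /and4P[/= a' b' c' d'] := cell_close _ (pos_bd u).
  by apply/and4P; split=> /=; lra.
have disjSS u v p : S u p -> S v p -> u = v.
  move=> /S_close/sup_close_sym su /S_close sv; apply/eqP; apply: contraT => /pos_sep/negP; case.
  by apply: sup_close_trans su sv _; lra.
have disjSN u v w p : e w v -> near w v p -> S u p -> u = w \/ u = v.
  move=> wv /asboolP[t t01 pt] su.
  have [->|uw] := eqVneq u w; first by left.
  have [->|uv] := eqVneq u v; first by right.
  case/negP: (arc_pos_sep _ _ _ _ wv t01 uw uv).
  by apply: sup_close_trans (sup_close_sym pt) (S_close _ _ su) _; lra.
have farS u p q : sup_close 2 (corner p) q -> ~~ S u p -> ~~ sup_close r q (pos u).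
  by move=> pq; apply: contraNN => qu; apply: close_S; apply: sup_close_trans pq qu _; lra.
exists (Num.truncn (M + r + 10)).+1, C, (fun u => cell (pos u)); split.
- move=> u p Cp.
  suff : [/\ 0 < (corner p).1, (corner p).1 <= M + r + 10, 0 < (corner p).2
           & (corner p).2 <= M + r + 10].
    case=> /= h1 h2 h3 h4; rewrite !ltr0n in h1 h3; rewrite h1 h3 /= !ltnS.
    by rewrite !truncn_ge_nat ?h2 ?h4 //; apply: le_trans h2.
  case/orP: Cp => [su|/existsP[v /and4P[/andP[uv _] /asboolP[t t01 pt] _ _]]].
    have [a b c d] := pos_bd u; have /and4P[a' b' c' d'] := S_close _ _ su.
    by split; lra.
  have [a b c d] := arc_bd _ _ _ uv t01; have /and4P[a' b' c' d'] := pt.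
  by split; lra.
- have disjC u w p : S u p -> C w p -> u = w.
    move=> su /orP[/(disjSS _ _ _ su)//|/existsP[v /and4P[/andP[wv _] nv nw nv']]].
    by case: (disjSN _ _ _ _ wv nv su) => // uv; rewrite -uv su in nv'.
  move=> u w p Cu Cw; have [su|nsu] := boolP (S u p); first exact: disjC Cw.
  have [sw|nsw] := boolP (S w p); first by apply/esym; apply: disjC Cu.
  move: Cu Cw; rewrite /C (negPf nsu) (negPf nsw) /=.
  move=> /existsP[v /and3P[/andP[uv rv] nuv nsv]] /existsP[x /and3P[/andP[wx rx] nwx nsx]].
  (* For one and the same edge the ranks force [u = w]. Otherwise the cell is within 2 of two
     different arcs, which [arc_sep] keeps more than 4 apart here. *)
  have [eq2|ne2] := eqVneq [set u; v]%SET [set w; x]%SET.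
    have := set21 u v; rewrite eq2 !inE => /orP[/eqP//|/eqP ux].
    have := set22 u v; rewrite eq2 !inE => /orP[/eqP vw|/eqP vx].
      by move: rv rx; rewrite ux vw => /ltn_trans h /h; rewrite ltnn.
    by move: rv; rewrite ux vx ltnn.
  case/asboolP: nuv => s s01 ps; case/asboolP: nwx => t t01 pt.
  have := arc_sep _ _ _ _ _ _ uv wx ne2 s01 t01 (farS _ _ _ ps nsu) (farS _ _ _ ps nsv).
  case/negP; apply: sup_close_trans (sup_close_sym ps) pt _; lra.
have SC u p : S u p -> C u p by move=> su; rewrite /C su.
have S0 u : S u (cell (pos u)) by rewrite /S /grid_square !leq_addr.
have main u v : ori u v -> exists x y, [/\ grid_reach (C u) (cell (pos u)) x,
    grid_adj x y & grid_reach (C v) (cell (pos v)) y].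
  move=> uvo; have /andP[uv _] := uvo.
  have nuv : u != v by apply: contraTneq uv => ->; rewrite e_irr.
  pose f m := arc u v (m%:R / N%:R).
  (* A staircase of $2N$ steps: odd steps update the first coordinate and even steps the second, so
     that consecutive cells are adjacent. *)
  pose w i : nat * nat := (Num.truncn (f (uphalf i)).1, Num.truncn (f i./2).2).
  have m01 m : (m <= N)%N -> in01 (m%:R / N%:R : R).
    move=> mN; rewrite /in01 divr_ge0 //= ler_pdivrMr ?ltr0n // mul1r.
    by rewrite ler_nat.
  have bd m : (m <= N)%N -> in_box (r + 10) M (f m) by move=> mN; apply: arc_bd (m01 _ _).
  have bd0 m : (m <= N)%N -> 0 <= (f m).1 /\ 0 <= (f m).2.
    by move=> /bd[h _ h' _]; split; [apply: le_trans h|apply: le_trans h']; lra.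
  have half_lt i : (i < N.*2)%N -> (i./2 < N)%N by rewrite ltn_half_double.
  have half_le i : (i <= N.*2)%N -> (i./2 <= N)%N.
    by move=> /half_leq; rewrite doubleK.
  have near_w i : (i <= N.*2)%N -> near u v (w i).
    move=> iN; have u2 : (uphalf i <= N)%N by rewrite leq_uphalf_double.
    apply/asboolP; exists ((i./2)%:R / N%:R); first exact: m01 (half_le _ iN).
    have /and4P[_ _ /= c d] := cell_close _ (bd _ (half_le _ iN)).
    have /and4P[/= a b _ _] := cell_close _ (bd _ u2).
    have : sup_close 1 (f (uphalf i)) (f i./2).
      move: u2; rewrite uphalf_half; case: (odd i) => u2; last first.
        by apply/and4P; rewrite !subrr ler01.
      exact: sup_close_sym (arc_step _ _ _ uv u2).
    case/and4P=> a' b' _ _; apply/and4P; rewrite /corner /w -/(f _) /=.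
    move: a b c d a' b' => a b c d a' b'.
    by clear -a b c d a' b'; split; lra.
  have step m : (m < N)%N -> sup_close 1 (f m) (f m.+1) by move=> mN; apply: arc_step.
  have adj_w i : (i < N.*2)%N -> grid_adj (w i) (w i.+1).
    move=> /half_lt iN; rewrite /w /= uphalf_half.
    have [a0 b0] := bd0 _ (ltnW iN); have [c0 d0] := bd0 _ iN.
    have /and4P[s1 s2 s3 s4] := step _ iN.
    by case: (odd i); rewrite ?add1n ?add0n;
      [apply: grid_adj_r|apply: grid_adj_l]; apply: truncn_step.
  apply: (@walk_branch w (S u) (S v) _ _ _ _ N.*2) => //.
  - by move=> p; apply: grid_square_reach => q; apply: SC.
  - by move=> p; apply: grid_square_reach => q; apply: SC.
  - by rewrite /w /f /= mul0r arc0.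
  - by rewrite /w /f uphalf_double doubleK divff ?arc1 // pnatr_eq0 -lt0n.
  - by move=> p su /(disjSS _ _ _ su)/eqP; rewrite (negPf nuv).
  move=> i iN nu nv; rewrite /C; apply/orP; right; apply/existsP; exists v.
  by rewrite uvo near_w // nu nv.
move=> u v uv.
have [lt|lt|/ord_inj/enum_rank_inj eq] := ltngtP (enum_rank u) (enum_rank v).
- by apply: main; rewrite /ori uv.
- have [|y [x [ry yx rx]]] := main v u; first by rewrite /ori e_sym uv.
  exists x, y; split=> //; move: yx; rewrite /grid_adj.
  by case/or4P=> [/eqP->|->|->|/orP[]->]; rewrite ?eqxx ?orbT.
- by move: uv; rewrite eq e_irr.
Qed.

(** * Separation constants and rescaling of a drawing *)

Section Separation.
Variable R : realType.
Implicit Types (f g : R -> R * R) (p q : R * R).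

Lemma sup_farW (d d' : R) p q : ~~ sup_close d p q -> d' <= d -> ~~ sup_close d' p q.
Proof. by move=> far le; apply: contraNN far => cl; apply: sup_closeW cl le. Qed.

Lemma arc_point_separation f p : cont01 f -> (forall t, in01 t -> f t <> p) ->
  exists2 d, 0 < d & forall t, in01 t -> ~~ sup_close d (f t) p.
Proof.
move=> cf fp; apply: (@unit_itv_uniform R (fun d t => ~~ sup_close d (f t) p)).
  by move=> d d' t _ le far; apply: sup_farW far le.
move=> t t01; have [d d0 far] := neq_far (fp t t01).
have [d1 d10 d1P] := cf t t01 (d / 2) ltac:(lra).
exists (Num.min d1 (d / 2)); first by rewrite lt_min d10; lra.
have [m1 m2] : Num.min d1 (d / 2) <= d1 /\ Num.min d1 (d / 2) <= d / 2.
  by rewrite !ge_min !lexx orbT.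
move=> s s01 l1 l2; apply: contraNN far => cl.
apply: sup_close_trans (sup_close_sym (d1P s s01 _ _)) cl _; lra.
Qed.

(** Near a common point, $f$ stays within $r$ of [p] or [q] and the claim is vacuous; elsewhere
    continuity keeps the arcs apart. Compactness makes the distance uniform. *)
Lemma arc_arc_separation f g p q (r : R) : 0 < r -> cont01 f -> cont01 g ->
  (forall s t, in01 s -> in01 t -> f s = g t -> f s = p \/ f s = q) ->
  exists2 d, 0 < d & forall s t, in01 s -> in01 t ->
    ~~ sup_close r (f s) p -> ~~ sup_close r (f s) q -> ~~ sup_close d (f s) (g t).
Proof.
move=> r0 cf cg fg.
apply: (@unit_square_uniform R (fun d s t =>
  ~~ sup_close r (f s) p -> ~~ sup_close r (f s) q -> ~~ sup_close d (f s) (g t))).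
  by move=> d d' s t _ le far h1 h2; apply: sup_farW (far h1 h2) le.
move=> s t s01 t01; have [eq|ne] := pselect (f s = g t).
  have [d d0 dP] := cf s s01 r r0; exists d => // s' t' s'01 t'01 l1 l2 l3 l4.
  have := dP s' s'01 l1 l2.
  by case: (fg s t s01 t01 eq) => -> ->.
have [d d0 far] := neq_far ne.
have [d1 d10 d1P] := cf s s01 (d / 4) ltac:(lra).
have [d2 d20 d2P] := cg t t01 (d / 4) ltac:(lra).
pose m := Num.min (Num.min d1 d2) (d / 4).
have [m1 m2 m3] : [/\ m <= d1, m <= d2 & m <= d / 4] by rewrite !ge_min !lexx !orbT.
exists m; first by rewrite !lt_min d10 d20; lra.
move=> s' t' s'01 t'01 l1 l2 l3 l4 _ _; apply: contraNN far => cl.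
have c1 := sup_close_sym (d1P s' s'01 ltac:(lra) ltac:(lra)).
have c2 := d2P t' t'01 ltac:(lra) ltac:(lra).
apply: sup_close_trans (sup_close_trans c1 cl (lexx _)) c2 _; lra.
Qed.

Definition rescale (h B : R) p : R * R := ((p.1 + B) / h, (p.2 + B) / h).

Lemma sup_close_rescale h B d p q : 0 < h ->
  sup_close d (rescale h B p) (rescale h B q) = sup_close (d * h) p q.
Proof.
move=> h0; have aux (x y : R) : ((x + B) / h - (y + B) / h <= d) = (x - y <= d * h).
  by rewrite -mulrBl ler_pdivrMr // opprD addrACA subrr addr0.
by rewrite /sup_close /= !aux.
Qed.
End Separation.

(** Compactness yields in turn a radius [r] isolating each vertex, a distance [d] between arcs
    outside these radii, a mesh [h] and a time step [eta]. Rescaling by [h] gives the unit mesh. *)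
Lemma planar_grid_minor (R : realType) (T : finType) (e : rel T) :
  simple_graph e -> planar R e -> grid_minor e.
Proof.
move=> [e_sym e_irr] [pos [arc [pos_inj arcP]]].
have cont u v : e u v -> cont01 (arc u v) by move=> /arcP[/within_cont01].
have [r1 r10 r1P] : exists2 d : R, 0 < d &
    forall i : T * T, i.1 != i.2 -> ~~ sup_close d (pos i.1) (pos i.2).
  apply: (@fin_uniform R _ (fun d i => i.1 != i.2 -> ~~ sup_close d (pos i.1) (pos i.2))).
    by move=> d d' i _ le far ne; apply: sup_farW (far ne) le.
  move=> [u v] /=; have [_|ne] := eqVneq u v; first by exists 1.
  have [|d d0 far] := @neq_far R (pos u) (pos v); first by move/pos_inj/eqP; rewrite (negPf ne).
  by exists d.
pose Q2 (d : R) (i : T * T * T) := e i.1.1 i.1.2 -> i.2 != i.1.1 -> i.2 != i.1.2 ->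
  forall t, in01 t -> ~~ sup_close d (arc i.1.1 i.1.2 t) (pos i.2).
have [r2 r20 r2P] : exists2 d : R, 0 < d & forall i, Q2 d i.
  apply: fin_uniform.
    by move=> d d' i _ le far h1 h2 h3 t t01; apply: sup_farW (far h1 h2 h3 t t01) le.
  move=> [[u v] w]; rewrite /Q2 /=.
  have [uv|_] := boolP (e u v); last by exists 1.
  have [_|nu] := eqVneq w u; first by exists 1.
  have [_|nv] := eqVneq w v; first by exists 1.
  have [|d d0 dP] := arc_point_separation (p := pos w) (cont _ _ uv); last by exists d.
  move=> t t01 atw; have [_ _ _ aw _] := arcP _ _ uv.
  by have [/eqP|/eqP] := aw w t t01 atw; rewrite ?(negPf nu) ?(negPf nv).
pose r := Num.min r1 r2 / 8.
have r0 : 0 < r by rewrite divr_gt0 // lt_min r10.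
have [rr1 rr2] : 8 * r <= r1 /\ 8 * r <= r2.
  have [] : Num.min r1 r2 <= r1 /\ Num.min r1 r2 <= r2 by rewrite !ge_min !lexx orbT.
  by rewrite /r; split; lra.
pose Q3 (d : R) (i : (T * T) * (T * T)) := e i.1.1 i.1.2 -> e i.2.1 i.2.2 ->
  [set i.1.1; i.1.2]%SET != [set i.2.1; i.2.2]%SET ->
  forall s t, in01 s -> in01 t -> ~~ sup_close r (arc i.1.1 i.1.2 s) (pos i.1.1) ->
  ~~ sup_close r (arc i.1.1 i.1.2 s) (pos i.1.2) ->
  ~~ sup_close d (arc i.1.1 i.1.2 s) (arc i.2.1 i.2.2 t).
have [d d0 dP] : exists2 d : R, 0 < d & forall i, Q3 d i.
  apply: fin_uniform.
    move=> d d' i _ le far h1 h2 h3 s t s01 t01 h4 h5.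
    exact: sup_farW (far h1 h2 h3 s t s01 t01 h4 h5) le.
  move=> [[u v] [x y]]; rewrite /Q3 /=.
  have [uv|_] := boolP (e u v); last by exists 1.
  have [xy|_] := boolP (e x y); last by exists 1.
  have [_|ne] := eqVneq [set u; v]%SET [set x; y]%SET; first by exists 1.
  have [|d d0 dP] := @arc_arc_separation R (arc u v) (arc x y) (pos u) (pos v) r r0
      (cont _ _ uv) (cont _ _ xy); last by exists d.
  move=> s t s01 t01 eq; have [_ _ _ _ ax] := arcP _ _ uv.
  have [w] := ax x y s t xy ne s01 t01 eq.
  by rewrite !inE => /andP[/orP[] /eqP-> _] ->; [left|right].
(* In units of [h] the radius [r] must be at least 10 and [d] at least 4. *)
pose h := Num.min d r / 10.
have h0 : 0 < h by rewrite divr_gt0 // lt_min d0.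
have [hd hr] : 4 * h <= d /\ 10 * h <= r.
  have [] : Num.min d r <= d /\ Num.min d r <= r by rewrite !ge_min !lexx orbT.
  by rewrite /h; split; lra.
have [eta eta0 etaP] : exists2 eta : R, 0 < eta & forall i : T * T, e i.1 i.2 ->
    forall s t, in01 s -> in01 t -> s - t <= eta -> t - s <= eta ->
    sup_close h (arc i.1 i.2 s) (arc i.1 i.2 t).
  apply: (@fin_uniform R _ (fun eta i => e i.1 i.2 ->
    forall s t, in01 s -> in01 t -> s - t <= eta -> t - s <= eta ->
    sup_close h (arc i.1 i.2 s) (arc i.1 i.2 t))).
    move=> a a' i _ le hyp ei s t s01 t01 l1 l2.
    by apply: hyp => //; [apply: le_trans l1 le|apply: le_trans l2 le].
  move=> [u v] /=; have [uv|_] := boolP (e u v); last by exists 1.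
  by have [a a0 aP] := cont01_uniform (cont _ _ uv) h0; exists a.
have [m1 m10 m1P] : exists2 m : R, 0 < m & forall i : T * T, e i.1 i.2 ->
    forall t, in01 t -> sup_close m^-1 (arc i.1 i.2 t) (0, 0).
  apply: (@fin_uniform R _ (fun m i => e i.1 i.2 ->
    forall t, in01 t -> sup_close m^-1 (arc i.1 i.2 t) (0, 0))).
    move=> a a' i a0 le hyp ei t t01; apply: sup_closeW (hyp ei t t01) _.
    by rewrite lef_pV2 // posrE (lt_le_trans a0).
  move=> [u v] /=; have [uv|_] := boolP (e u v); last by exists 1.
  by have [a a0 aP] := cont01_bounded (cont _ _ uv); exists a.
have [m2 m20 m2P] : exists2 m : R, 0 < m & forall u, sup_close m^-1 (pos u) (0, 0).
  apply: (@fin_uniform R _ (fun m u => sup_close m^-1 (pos u) (0, 0))).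
    move=> a a' u a0 le hyp; apply: sup_closeW hyp _.
    by rewrite lef_pV2 // posrE (lt_le_trans a0).
  move=> u; have [|a a0 aP] := @cont01_bounded R (fun=> pos u).
    by move=> t t01 a a0; exists 1 => // s _ _ _; apply/and4P; rewrite !subrr; split; apply: ltW.
  by exists a => //; apply: (aP 0); rewrite /in01 lexx ler01.
(* [M0] bounds the coordinates of the drawing; translation by [B] puts it at distance at least
   $r+10h$ from the axes. *)
pose M0 := m1^-1 + m2^-1; pose B := M0 + r + 10 * h.
have [m1V m2V] : 0 < m1^-1 /\ 0 < m2^-1 by rewrite !invr_gt0.
(* Then $1/N\le$ [eta], so an arc moves by at most [h] in one time step. *)
pose N := (Num.truncn eta^-1).+1.
have box p : sup_close M0 p (0, 0) -> in_box (r / h + 10) ((M0 + B) / h) (rescale h B p).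
  case/and4P=> /= a b c c'; rewrite /in_box /rescale /=.
  have -> : r / h + 10 = (r + 10 * h) / h by rewrite mulrDl mulfK // gt_eqF.
  by rewrite !ler_pM2r ?invr_gt0 // /B; split; lra.
have hV x : x * h / h = x by rewrite mulfK // gt_eqF.
have Vh x : x / h * h = x by rewrite mulfVK // gt_eqF.
apply: (@unit_mesh_grid_minor R T e (fun u => rescale h B (pos u))
  (fun u v t => rescale h B (arc u v t)) (r / h) ((M0 + B) / h) N) => //.
- by rewrite ler_pdivlMr.
- by move=> u; apply: box; apply: sup_closeW (m2P u) _; rewrite /M0; lra.
- by move=> u v t uv t01; apply: box; apply: sup_closeW (m1P (u, v) uv t t01) _; rewrite /M0; lra.
- by move=> u v /arcP[_ _ [-> _]].
- by move=> u v /arcP[_ _ [_ ->]].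
- move=> u v uv; rewrite sup_close_rescale // -mulrA Vh.
  by apply: sup_farW (r1P (u, v) uv) rr1.
- move=> u v w t uv t01 wu wv; rewrite sup_close_rescale // -mulrA Vh.
  by apply: sup_farW (r2P (u, v, w) uv wu wv t t01) rr2.
- move=> u v x y s t uv xy ne s01 t01; rewrite !sup_close_rescale // Vh => f1 f2.
  by apply: sup_farW (dP ((u, v), (x, y)) uv xy ne s t s01 t01 f1 f2) hd.
move=> u v m uv mN; rewrite sup_close_rescale // mul1r.
have N0 : 0 < N%:R :> R by rewrite ltr0n.
have N1 : N%:R^-1 <= eta.
  rewrite -[leRHS]invrK lef_pV2 ?posrE ?invr_gt0 //; apply: ltW.
  have eta_ge0 : 0 <= eta^-1 by rewrite invr_ge0 ltW.
  by have /andP[] := truncn_itv eta_ge0.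
have m01 i : (i <= N)%N -> in01 (i%:R / N%:R : R).
  by move=> iN; rewrite /in01 divr_ge0 //= ler_pdivrMr // mul1r ler_nat.
have stepE : m.+1%:R / N%:R = m%:R / N%:R + N%:R^-1 :> R.
  by rewrite mulrSr mulrDl mul1r.
have Ni0 : 0 < N%:R^-1 :> R by rewrite invr_gt0.
by apply: (etaP (u, v) uv); rewrite ?m01 ?(ltnW mN) // stepE; lra.
Qed.
End Drawing.

(** * From the drawing through sparsity to both choosability statements *)

Theorem theorem3 (R : realType) (T : finType) (e : rel T) :
  simple_graph e -> planar R e ->
  no_intersecting_triangles e -> triangles_adj_at_most_one_4cycle e ->
  adaptably_choosable e 3 /\ kd_choosable e 3 1.
Proof.
move=> sg pl nit adj; have [e_sym e_irr] := sg.
have minor := planar_grid_minor sg pl.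
have ch : adaptably_choosable e 3.
  apply: sparse_adaptably_choosable => S.
  by apply: dual_sparse => // A; apply: grid_minor_dual.
by split=> //; apply: adaptably_choosable_kd.
Qed.
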